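(* Consider real solutions $u\in C(\mathbb R;H^1(\mathbb T;\mathbb R))$ of $$(1-\partial_x^2)u_t+\partial_x\Big(u+\frac{u^2}{2}\Big)=0\qquad\text{on }\mathbb T\times\mathbb R,$$ let $\psi(\cdot,t)=(1-\partial_x^2)^{-1}\big(u(\cdot,t)+\tfrac12u(\cdot,t)^2\big)$, and let $x_0\in\mathbb T$. (i) If $\psi(x_0,t)=-\frac12$ at a single time $t\in\mathbb R$, then $u\equiv-1$ on $\mathbb T\times\mathbb R$. (ii) The equation is invariant under $u(x,t)\mapsto-2-u(2x_0-x,t)$. If $u(\cdot,0)=u_0$ where $1+u_0$ is odd with respect to $x_0$ and not identically zero (for instance $u_0(x)=-1+\sin(x-x_0)$), then $u(x_0,t)=-1$ for all $t\in\mathbb R$, while $u$ is not constant.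
   Context: $\mathbb T=\mathbb R/(2\pi\mathbb Z)$. A solution $u\in C(\mathbb R;H^1(\mathbb T;\mathbb R))$ is understood in the sense of distributions; equivalently, $u\in C^1(\mathbb R;H^1(\mathbb T))$ and $u_t=-\psi_x$ for all $t$. $(1-\partial_x^2)^{-1}$ is the Fourier multiplier $(1+k^2)^{-1}$ on $\mathbb T$. A function $g$ on $\mathbb T$ is odd with respect to $x_0$ if $g(2x_0-x)=-g(x)$ for all $x$. Point values refer to continuous representatives. *)

(* Defs.v *)
From Stdlib Require Import Reals ZArith.
From Coquelicot Require Import Coquelicot.

Open Scope R_scope.

(* A function on T = R/(2 pi Z) is a 2 pi-periodic function on R, and a point
   of T is given by any of its representatives in R. *)
Definition periodic (f : R -> R) : Prop := forall x, f (x + 2 * PI) = f x.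

Definition ex_seriesZ (a : Z -> R) : Prop :=
  ex_series (fun n : nat => a (Z.of_nat n)) /\
  ex_series (fun n : nat => a (- Z.of_nat (S n))%Z).

Definition SeriesZ (a : Z -> R) : R :=
  Series (fun n : nat => a (Z.of_nat n)) +
  Series (fun n : nat => a (- Z.of_nat (S n))%Z).

(* e^{i theta} *)
Definition cis (theta : R) : C := (cos theta, sin theta).

(* (1 / 2 pi) \int_0^{2 pi} f(x) e^{-ikx} dx for real-valued f; only applied to
   continuous f, so that the Riemann integral is the Lebesgue one. *)
Definition fourier (f : R -> R) (k : Z) : C :=
  (/ (2 * PI) * RInt (fun x => f x * cos (IZR k * x)) 0 (2 * PI),
   - (/ (2 * PI) * RInt (fun x => f x * sin (IZR k * x)) 0 (2 * PI))).

Definition H1_weight (f : R -> R) (k : Z) : R :=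
  (1 + IZR k ^ 2) * Cmod (fourier f k) ^ 2.

(* H^1(T; R), each element being identified with its continuous
   representative. *)
Definition in_H1 (f : R -> R) : Prop :=
  periodic f /\ (forall x, continuous f x) /\ ex_seriesZ (H1_weight f).

Definition H1_norm (f : R -> R) : R := sqrt (SeriesZ (H1_weight f)).

(* u \in C(R; H^1(T; R)); the value of u at x \in T, t \in R is [u x t]. *)
Definition C_H1 (u : R -> R -> R) : Prop :=
  (forall t, in_H1 (fun x => u x t)) /\
  (forall t, filterlim (fun s => H1_norm (fun x => u x s - u x t))
                       (locally t) (locally 0)).

(* Smooth functions on T x R vanishing for |t| >= M. *)
Definition test_function (M : R) (phi : R -> R -> R) : Prop :=
  (forall t, periodic (fun x => phi x t)) /\
  (forall n x t, ex_diff_n phi n x t) /\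
  (forall x t, M <= Rabs t -> phi x t = 0).

(* (1 - d_x^2) u_t + d_x (u + u^2/2) = 0 in the sense of distributions on
   T x R. In [partial_derive m n phi x t], m counts x-derivatives and n counts
   t-derivatives; both terms change sign when the derivatives are moved onto
   phi. *)
Definition BBM_distributional (u : R -> R -> R) : Prop :=
  forall (M : R) (phi : R -> R -> R), 0 < M -> test_function M phi ->
    RInt (fun t => RInt (fun x =>
        u x t * (partial_derive 0 1 phi x t - partial_derive 2 1 phi x t)
        + (u x t + u x t ^ 2 / 2) * partial_derive 1 0 phi x t)
      0 (2 * PI)) (- M) M = 0.

Definition BBM_solution (u : R -> R -> R) : Prop :=
  C_H1 u /\ BBM_distributional u.

(* (1 - d_x^2)^{-1} f as the Fourier multiplier (1 + k^2)^{-1}. For real f the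
   terms k and -k are conjugate, so taking real parts loses nothing. For
   continuous f the series converges absolutely and uniformly, and its sum is
   the continuous representative. *)
Definition inv_helmholtz (f : R -> R) (x : R) : R :=
  SeriesZ (fun k =>
    Re (Cmult (RtoC (/ (1 + IZR k ^ 2))) (Cmult (fourier f k) (cis (IZR k * x))))).

Definition psi (u : R -> R -> R) (x t : R) : R :=
  inv_helmholtz (fun y => u y t + / 2 * u y t ^ 2) x.

Definition odd_about (x0 : R) (g : R -> R) : Prop :=
  forall x, g (2 * x0 - x) = - g x.

(* Main.v *)
Require Import Defs.
From Stdlib Require Import Reals ZArith Lra Lia Psatz FunctionalExtensionality.
From Coquelicot Require Import Coquelicot.

Open Scope R_scope.

(* With v = 1 + u the flux is u + u^2/2 = (v^2 - 1)/2, so psi + 1/2 is the Green operator applied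
   to v^2/2. The Green kernel is bounded below by a positive constant, because its Fourier
   coefficients 1/(1 + k^2) form a convex sequence and the kernel is therefore a nonnegative
   combination of Fejer kernels. Hence psi(x0,t) = -1/2 forces v(.,t) = 0. Everything else is
   uniqueness: a solution with v(.,t) = 0 coincides with all of its reflections
   -2 - u(c - x,t), and a solution with odd 1 + u_0 coincides with its reflection about x0.

   For uniqueness, testing with chi(t) cos(kx) and chi(t) sin(kx) (du Bois-Reymond) gives an
   integral equation for each Fourier mode of the difference d of two solutions. Summing the modes
   with Bessel's inequality bounds the partial Fourier sums of d(.,t) by a constant times the time
   integral of sup |d|; Fejer's theorem passes this bound to d itself, and the weight
   exp(L |t - t0|) turns it into a contraction. *)

(** * Integrals and means over a period *)

(** Solutions are only continuous in time with values in H^1, and H^1 is given by Fourier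
    coefficients, so neither u_t nor u_x can be handled pointwise; this is why every estimate is
    made on partial Fourier sums. For a merely continuous function these sums need not converge, but
    a bound uniform in the number of modes survives averaging, and Fejer means converge at every
    point. The same kernels thus serve twice: they recover a function from its modes, and their
    positivity bounds the Green kernel from below without its closed form in cosh. The quadratic
    flux is only locally Lipschitz in the sup norm. This calls for a Sobolev bound, which also gives
    joint continuity, and for work on bounded time intervals. The operator d_x (1 - d_x^2)^{-1} is
    bounded in the sup norm because its symbol n/(1 + n^2) is square summable. Comparing with
    reflections, rather than with the constant solution -1, lets a single invariance lemma serve (i)
    and (ii). *)

Definition cont (f : R -> R) : Prop := forall x, continuous f x.

Lemma cont_const (c : R) : cont (fun _ => c).
Proof. intros x; apply continuous_const. Qed.

Lemma cont_id : cont (fun x => x).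
Proof. intros x; apply continuous_id. Qed.

Lemma cont_plus (f g : R -> R) : cont f -> cont g -> cont (fun x => f x + g x).
Proof. intros Hf Hg x; apply (continuous_plus f g x (Hf x) (Hg x)). Qed.

Lemma cont_mult (f g : R -> R) : cont f -> cont g -> cont (fun x => f x * g x).
Proof. intros Hf Hg x; apply (continuous_mult f g x (Hf x) (Hg x)). Qed.

Lemma cont_opp (f : R -> R) : cont f -> cont (fun x => - f x).
Proof. intros Hf x; apply (continuous_opp f x (Hf x)). Qed.

Lemma cont_minus (f g : R -> R) : cont f -> cont g -> cont (fun x => f x - g x).
Proof. intros Hf Hg; apply cont_plus; [exact Hf | now apply cont_opp]. Qed.

Lemma cont_comp (f g : R -> R) : cont g -> cont f -> cont (fun x => f (g x)).
Proof. intros Hg Hf x; apply (continuous_comp g f x (Hg x) (Hf (g x))). Qed.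

Lemma cont_pow (f : R -> R) (n : nat) : cont f -> cont (fun x => f x ^ n).
Proof.
intros Hf; induction n as [|n IH]; simpl; [apply cont_const | now apply cont_mult].
Qed.

Lemma cont_cos (f : R -> R) : cont f -> cont (fun x => cos (f x)).
Proof. intros Hf; apply (cont_comp cos f Hf); intros x; apply continuous_cos. Qed.

Lemma cont_sin (f : R -> R) : cont f -> cont (fun x => sin (f x)).
Proof. intros Hf; apply (cont_comp sin f Hf); intros x; apply continuous_sin. Qed.

Lemma cont_exp (f : R -> R) : cont f -> cont (fun x => exp (f x)).
Proof. intros Hf; apply (cont_comp exp f Hf); intros x; apply continuous_exp. Qed.

Lemma cont_Rabs (f : R -> R) : cont f -> cont (fun x => Rabs (f x)).
Proof. intros Hf; apply (cont_comp Rabs f Hf); intros x; apply continuous_Rabs. Qed.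

Lemma cont_derivable (f : R -> R) : (forall x, ex_derive f x) -> cont f.
Proof. intros H x; apply (ex_derive_continuous f), H. Qed.

(** Syntax-directed continuity. Division is unfolded so that a quotient by a constant is read as a
    product with a constant. *)
Ltac ct :=
  unfold Rdiv;
  repeat match goal with
  | H : cont ?f |- cont ?f => exact H
  | |- cont (fun x => x) => apply cont_id
  | |- cont (fun _ => ?c) => apply cont_const
  | H : cont ?f |- cont (fun x => ?f x) => exact H
  | |- cont (fun x => @?f x + @?g x) => apply (cont_plus f g)
  | |- cont (fun x => @?f x - @?g x) => apply (cont_minus f g)
  | |- cont (fun x => @?f x * @?g x) => apply (cont_mult f g)
  | |- cont (fun x => - @?f x) => apply (cont_opp f)
  | |- cont (fun x => @?f x ^ ?n) => apply (cont_pow f n)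
  | |- cont (fun x => cos (@?f x)) => apply (cont_cos f)
  | |- cont (fun x => sin (@?f x)) => apply (cont_sin f)
  | |- cont (fun x => exp (@?f x)) => apply (cont_exp f)
  | |- cont (fun x => Rabs (@?f x)) => apply (cont_Rabs f)
  | H : cont ?f |- cont (fun x => ?f (@?g x)) => apply (cont_comp f g)
  | H : forall _, cont _ |- cont _ => apply H
  end.

Lemma cont_ex_RInt (f : R -> R) (a b : R) : cont f -> ex_RInt f a b.
Proof. intros H; apply (ex_RInt_continuous (V := R_CompleteNormedModule)); intros; apply H. Qed.

Lemma cont_eps (f : R -> R) (x e : R) : cont f -> 0 < e ->
  exists d, 0 < d /\ forall y, Rabs (y - x) < d -> Rabs (f y - f x) < e.
Proof.
intros Hf He.
destruct (proj1 (filterlim_locally f (f x)) (Hf x) (mkposreal e He)) as [d Hd].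
exists d; split; [apply cond_pos | intros y Hy; exact (Hd y Hy)].
Qed.

Lemma eps_cont (f : R -> R) :
  (forall x e, 0 < e -> exists d, 0 < d /\ forall y, Rabs (y - x) < d -> Rabs (f y - f x) < e) ->
  cont f.
Proof.
intros H x. apply (proj2 (filterlim_locally f (f x))). intros e.
destruct (H x e (cond_pos e)) as [d [Hd1 Hd2]].
exists (mkposreal d Hd1); intros y Hy; apply Hd2; exact Hy.
Qed.

Lemma RInt_eq (f g : R -> R) (a b : R) : (forall x, f x = g x) -> RInt f a b = RInt g a b.
Proof. intros H; apply RInt_ext; intros; apply H. Qed.

Lemma RInt_add (f g : R -> R) (a b : R) : cont f -> cont g ->
  RInt (fun x => f x + g x) a b = RInt f a b + RInt g a b.
Proof. intros Hf Hg; apply (RInt_plus f g); now apply cont_ex_RInt. Qed.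

Lemma RInt_sub (f g : R -> R) (a b : R) : cont f -> cont g ->
  RInt (fun x => f x - g x) a b = RInt f a b - RInt g a b.
Proof. intros Hf Hg; apply (RInt_minus f g); now apply cont_ex_RInt. Qed.

Lemma RInt_neg (f : R -> R) (a b : R) : cont f ->
  RInt (fun x => - f x) a b = - RInt f a b.
Proof. intros Hf; apply (RInt_opp f); now apply cont_ex_RInt. Qed.

Lemma RInt_mulc (c : R) (f : R -> R) (a b : R) : cont f ->
  RInt (fun x => c * f x) a b = c * RInt f a b.
Proof. intros Hf; apply (RInt_scal f); now apply cont_ex_RInt. Qed.

Lemma RInt_cst (c a b : R) : RInt (fun _ => c) a b = (b - a) * c.
Proof. apply (RInt_const (V := R_CompleteNormedModule)). Qed.

Lemma RInt_cut (f : R -> R) (a b c : R) : cont f -> RInt f a b + RInt f b c = RInt f a c.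
Proof. intros H; apply (RInt_Chasles f a b c); now apply cont_ex_RInt. Qed.

Lemma RInt_flip (f : R -> R) (a b : R) : cont f -> RInt f a b = - RInt f b a.
Proof.
intros H; generalize (RInt_cut f a b a H).
rewrite RInt_point; change (@zero _) with 0; lra.
Qed.

Lemma RInt_mono (f g : R -> R) (a b : R) : a <= b -> cont f -> cont g ->
  (forall x, a < x < b -> f x <= g x) -> RInt f a b <= RInt g a b.
Proof. intros ab Hf Hg H; apply RInt_le; auto using cont_ex_RInt. Qed.

Lemma RInt_abs_mono (f g : R -> R) (a b : R) : a <= b -> cont f -> cont g ->
  (forall x, a < x < b -> Rabs (f x) <= g x) -> Rabs (RInt f a b) <= RInt g a b.
Proof.
intros ab Hf Hg H.
apply Rle_trans with (RInt (fun x => Rabs (f x)) a b).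
- apply abs_RInt_le; auto using cont_ex_RInt.
- apply RInt_mono; auto. ct.
Qed.

Lemma RInt_fundamental (f f' : R -> R) (a b : R) :
  (forall x, is_derive f x (f' x)) -> cont f' -> RInt f' a b = f b - f a.
Proof.
intros Hd Hc; apply is_RInt_unique.
apply (is_RInt_derive f f'); intros; [apply Hd | apply Hc].
Qed.

Lemma is_derive_primitive (f : R -> R) (a x : R) : cont f ->
  is_derive (fun t => RInt f a t) x (f x).
Proof.
intros H. apply (is_derive_RInt f (fun t => RInt f a t) a x).
- apply filter_forall; intros t; apply (RInt_correct f); now apply cont_ex_RInt.
- apply H.
Qed.

Lemma RInt_shift (f : R -> R) (c a b : R) : cont f ->
  RInt (fun x => f (x + c)) a b = RInt f (a + c) (b + c).
Proof.
intros H.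
replace (a + c) with (1 * a + c) by ring; replace (b + c) with (1 * b + c) by ring.
rewrite <- (RInt_comp_lin f 1 c a b) by now apply cont_ex_RInt.
apply RInt_eq; intros x; unfold scal; simpl; unfold mult; simpl.
now rewrite !Rmult_1_l.
Qed.

Lemma RInt_reflect (f : R -> R) (c a b : R) : cont f ->
  RInt (fun x => f (c - x)) a b = RInt f (c - b) (c - a).
Proof.
intros H.
rewrite (RInt_flip f (c - b)) by exact H.
replace (c - a) with (-1 * a + c) by ring; replace (c - b) with (-1 * b + c) by ring.
rewrite <- (RInt_comp_lin f (-1) c a b) by now apply cont_ex_RInt.
rewrite (RInt_eq (fun y => scal (-1) (f (-1 * y + c))) (fun y => - f (c - y))).
- rewrite RInt_neg by ct. symmetry; apply Ropp_involutive.
- intros y; unfold scal; simpl; unfold mult; simpl.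
  replace (-1 * y + c) with (c - y) by ring; ring.
Qed.

Lemma periodic_Z (f : R -> R) (k : Z) (x : R) : periodic f -> f (x + 2 * PI * IZR k) = f x.
Proof.
intros Hp.
assert (N : forall (n : nat) y, f (y + 2 * PI * INR n) = f y).
{ induction n as [|n IH]; intros y.
  - simpl; now rewrite Rmult_0_r, Rplus_0_r.
  - rewrite S_INR. replace (y + 2 * PI * (INR n + 1)) with (y + 2 * PI * INR n + 2 * PI) by ring.
    now rewrite Hp, IH. }
destruct k as [|p|p].
- rewrite Rmult_0_r, Rplus_0_r; reflexivity.
- rewrite <- (positive_nat_Z p), <- INR_IZR_INZ; apply N.
- rewrite <- Pos2Z.opp_pos, opp_IZR, <- (positive_nat_Z p), <- INR_IZR_INZ.
  rewrite <- (N (Pos.to_nat p) (x + 2 * PI * - INR (Pos.to_nat p))).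
  f_equal; ring.
Qed.

Lemma periodic_reduce (x : R) : exists k : Z, 0 <= x + 2 * PI * IZR k <= 2 * PI.
Proof.
assert (HP := PI_RGT_0).
destruct (archimed (x / (2 * PI))) as [H1 H2].
exists (1 - up (x / (2 * PI)))%Z. rewrite minus_IZR.
replace (x + 2 * PI * (1 - IZR (up (x / (2 * PI)))))
  with (2 * PI * (x / (2 * PI) + 1 - IZR (up (x / (2 * PI))))) by (field; lra).
split.
- apply Rmult_le_pos; lra.
- apply Rle_trans with (2 * PI * 1); [apply Rmult_le_compat_l|]; lra.
Qed.

Lemma RInt_period (f : R -> R) (a : R) : cont f -> periodic f ->
  RInt f a (a + 2 * PI) = RInt f 0 (2 * PI).
Proof.
intros Hc Hp.
assert (E : RInt f (2 * PI) (a + 2 * PI) = RInt f 0 a).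
{ generalize (RInt_shift f (2 * PI) 0 a Hc); rewrite Rplus_0_l; intros <-.
  apply RInt_eq; exact Hp. }
generalize (RInt_cut f 0 a (a + 2 * PI) Hc) (RInt_cut f 0 (2 * PI) (a + 2 * PI) Hc).
lra.
Qed.

Definition mean (f : R -> R) : R := / (2 * PI) * RInt f 0 (2 * PI).

Lemma two_PI_pos : 0 < 2 * PI.
Proof. generalize PI_RGT_0; lra. Qed.

Lemma mean_ext (f g : R -> R) : (forall x, f x = g x) -> mean f = mean g.
Proof. intros H; unfold mean; f_equal; now apply RInt_eq. Qed.

Lemma mean_plus (f g : R -> R) : cont f -> cont g -> mean (fun x => f x + g x) = mean f + mean g.
Proof. intros Hf Hg; unfold mean; rewrite RInt_add by assumption; ring. Qed.

Lemma mean_minus (f g : R -> R) : cont f -> cont g -> mean (fun x => f x - g x) = mean f - mean g.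
Proof. intros Hf Hg; unfold mean; rewrite RInt_sub by assumption; ring. Qed.

Lemma mean_opp (f : R -> R) : cont f -> mean (fun x => - f x) = - mean f.
Proof. intros Hf; unfold mean; rewrite RInt_neg by assumption; ring. Qed.

Lemma mean_scal (c : R) (f : R -> R) : cont f -> mean (fun x => c * f x) = c * mean f.
Proof. intros Hf; unfold mean; rewrite RInt_mulc by assumption; ring. Qed.

Lemma mean_const (c : R) : mean (fun _ => c) = c.
Proof. unfold mean; rewrite RInt_cst; generalize two_PI_pos; intros; field; lra. Qed.

Lemma mean_mono (f g : R -> R) : cont f -> cont g -> (forall x, f x <= g x) -> mean f <= mean g.
Proof.
intros Hf Hg H; unfold mean. apply Rmult_le_compat_l.
- left; apply Rinv_0_lt_compat, two_PI_pos.
- apply RInt_mono; auto. left; apply two_PI_pos.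
Qed.

Lemma mean_abs_le (f g : R -> R) : cont f -> cont g -> (forall x, Rabs (f x) <= g x) ->
  Rabs (mean f) <= mean g.
Proof.
intros Hf Hg H; unfold mean. generalize (Rinv_0_lt_compat _ two_PI_pos); intros P.
rewrite Rabs_mult, (Rabs_pos_eq (/ (2 * PI))) by lra.
apply Rmult_le_compat_l; [lra|].
apply RInt_abs_mono; auto. left; apply two_PI_pos.
Qed.

Lemma mean_abs_le_const (f : R -> R) (M : R) : cont f -> (forall x, Rabs (f x) <= M) -> Rabs (mean f) <= M.
Proof. intros Hf H; rewrite <- (mean_const M); apply mean_abs_le; auto; ct. Qed.

Lemma mean_shift (f : R -> R) (c : R) : cont f -> periodic f -> mean (fun x => f (x + c)) = mean f.
Proof.
intros Hf Hp; unfold mean. rewrite RInt_shift by exact Hf.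
replace (2 * PI + c) with (0 + c + 2 * PI) by ring. now rewrite RInt_period.
Qed.

Lemma mean_reflect (f : R -> R) (c : R) : cont f -> periodic f -> mean (fun x => f (c - x)) = mean f.
Proof.
intros Hf Hp; unfold mean. rewrite RInt_reflect by exact Hf.
replace (c - 0) with (c - 2 * PI + 2 * PI) by ring. now rewrite RInt_period.
Qed.

(** A positive value at [x] persists on an interval [x, x + d]. The period is started at [x] instead
    of 0, so that this interval lies inside it whatever [x] is. *)
Lemma mean_eq_0 (f : R -> R) : cont f -> periodic f -> (forall x, 0 <= f x) -> mean f <= 0 ->
  forall x, f x = 0.
Proof.
intros Hc Hp Hpos Hm x.
destruct (Req_dec (f x) 0) as [|Hne]; auto. exfalso.
assert (Hx : 0 < f x) by (generalize (Hpos x); lra).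
destruct (cont_eps f x (f x) Hc Hx) as [d0 [Hd0 H0]].
pose (d := Rmin d0 PI).
assert (HP := PI_RGT_0).
assert (Hd : 0 < d) by (apply Rmin_glb_lt; lra).
assert (Hd1 : d <= d0) by apply Rmin_l.
assert (Hd2 : d <= PI) by apply Rmin_r.
assert (0 < RInt f x (x + d)).
{ apply RInt_gt_0; [lra| |intros; apply Hc].
  intros y Hy. assert (Hy' : Rabs (y - x) < d0) by (rewrite Rabs_pos_eq; lra).
  specialize (H0 y Hy'). apply Rabs_def2 in H0. lra. }
assert (0 <= RInt f (x + d) (x + 2 * PI)).
{ apply RInt_ge_0; [lra|now apply cont_ex_RInt|auto]. }
generalize (RInt_cut f x (x + d) (x + 2 * PI) Hc). rewrite RInt_period by auto.
unfold mean in Hm. intros E.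
assert (0 < / (2 * PI) * RInt f 0 (2 * PI)); [|lra].
apply Rmult_lt_0_compat; [apply Rinv_0_lt_compat; lra | lra].
Qed.

Lemma cos_period_Z (k : Z) : periodic (fun x => cos (IZR k * x)).
Proof.
intros x. rewrite Rmult_plus_distr_l.
assert (Hc : periodic cos) by (intros y; apply cos_2PI_alt || (rewrite cos_plus, cos_2PI, sin_2PI; ring)).
rewrite <- (periodic_Z cos k (IZR k * x) Hc). f_equal; ring.
Qed.

Lemma sin_period_Z (k : Z) : periodic (fun x => sin (IZR k * x)).
Proof.
intros x. rewrite Rmult_plus_distr_l.
assert (Hc : periodic sin) by (intros y; rewrite sin_plus, cos_2PI, sin_2PI; ring).
rewrite <- (periodic_Z sin k (IZR k * x) Hc). f_equal; ring.
Qed.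

Lemma mean_cos_Z (k : Z) : k <> 0%Z -> mean (fun x => cos (IZR k * x)) = 0.
Proof.
intros Hk. assert (Hk' : IZR k <> 0) by now apply not_0_IZR.
unfold mean. rewrite (RInt_fundamental (fun x => sin (IZR k * x) / IZR k)).
(* Periodicity at 0 replaces the value at 2 PI by the value at 0, so the endpoint terms cancel. *)
- rewrite (eq_trans (f_equal (fun y => sin (IZR k * y)) (eq_sym (Rplus_0_l (2 * PI)))) (sin_period_Z k 0)).
  unfold Rminus; rewrite Rplus_opp_r; ring.
- intros x; auto_derive; [exact I | field; exact Hk'].
- ct.
Qed.

Lemma mean_sin_Z (k : Z) : mean (fun x => sin (IZR k * x)) = 0.
Proof.
destruct (Z.eq_dec k 0) as [->|Hk].
- rewrite (mean_ext _ (fun _ => 0)); [apply mean_const|].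
  intros x; now rewrite Rmult_0_l, sin_0.
- assert (Hk' : IZR k <> 0) by now apply not_0_IZR.
  unfold mean. rewrite (RInt_fundamental (fun x => - cos (IZR k * x) / IZR k)).
  + rewrite (eq_trans (f_equal (fun y => cos (IZR k * y)) (eq_sym (Rplus_0_l (2 * PI)))) (cos_period_Z k 0)).
    unfold Rminus; rewrite Rplus_opp_r; ring.
  + intros x; auto_derive; [exact I | field; exact Hk'].
  + ct.
Qed.

(** The means on the right stay unevaluated: each is 1 or 0 according to whether its frequency
    vanishes, so one formula gives both orthogonality and normalization. *)
Lemma mean_cos_cos (j k : Z) :
  mean (fun x => cos (IZR j * x) * cos (IZR k * x)) =
  / 2 * mean (fun x => cos (IZR (j - k) * x)) + / 2 * mean (fun x => cos (IZR (j + k) * x)).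
Proof.
rewrite <- !mean_scal, <- mean_plus by ct. apply mean_ext; intros x.
rewrite minus_IZR, plus_IZR, Rmult_minus_distr_r, Rmult_plus_distr_r, cos_minus, cos_plus; field.
Qed.

Lemma mean_sin_sin (j k : Z) :
  mean (fun x => sin (IZR j * x) * sin (IZR k * x)) =
  / 2 * mean (fun x => cos (IZR (j - k) * x)) - / 2 * mean (fun x => cos (IZR (j + k) * x)).
Proof.
rewrite <- !mean_scal, <- mean_minus by ct. apply mean_ext; intros x.
rewrite minus_IZR, plus_IZR, Rmult_minus_distr_r, Rmult_plus_distr_r, cos_minus, cos_plus; field.
Qed.

Lemma mean_sin_cos (j k : Z) : mean (fun x => sin (IZR j * x) * cos (IZR k * x)) = 0.
Proof.
transitivity (/ 2 * mean (fun x => sin (IZR (j - k) * x)) + / 2 * mean (fun x => sin (IZR (j + k) * x))).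
- rewrite <- !mean_scal, <- mean_plus by ct. apply mean_ext; intros x.
  rewrite minus_IZR, plus_IZR, Rmult_minus_distr_r, Rmult_plus_distr_r, sin_minus, sin_plus; field.
- rewrite !mean_sin_Z; ring.
Qed.

(** * Fejer kernels and Bessel's inequality *)

Lemma cont_periodic_bounded (f : R -> R) : cont f -> periodic f ->
  exists M, 0 <= M /\ forall x, Rabs (f x) <= M.
Proof.
intros Hc Hp.
destruct (continuity_ab_maj (fun x => Rabs (f x)) 0 (2 * PI)) as [m [Hm _]].
- left; apply two_PI_pos.
- intros c _. apply continuity_pt_filterlim. apply (cont_Rabs f Hc).
- exists (Rabs (f m)); split; [apply Rabs_pos|]. intros x.
  destruct (periodic_reduce x) as [k Hk]. rewrite <- (periodic_Z f k x Hp). now apply Hm.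
Qed.

Lemma cos_period_INR (n : nat) : periodic (fun x => cos (INR n * x)).
Proof. rewrite INR_IZR_INZ; apply cos_period_Z. Qed.

Lemma sin_period_INR (n : nat) : periodic (fun x => sin (INR n * x)).
Proof. rewrite INR_IZR_INZ; apply sin_period_Z. Qed.

(** At [w = IZR k], [fcos] and [fsin] are the real part and the negated imaginary part of
    [fourier f k]. The frequency is real so that [INR n] and [IZR k] both fit. *)
Definition fcos (f : R -> R) (w : R) : R := mean (fun x => f x * cos (w * x)).
Definition fsin (f : R -> R) (w : R) : R := mean (fun x => f x * sin (w * x)).

Fixpoint sum1 (h : nat -> R) (N : nat) : R :=
  match N with O => 0 | S m => sum1 h m + h (S m) end.

Lemma sum1_le (h g : nat -> R) (N : nat) : (forall n, (1 <= n)%nat -> h n <= g n) -> sum1 h N <= sum1 g N.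
Proof. intros H; induction N as [|N IH]; simpl; [lra|]. generalize (H (S N) ltac:(lia)); lra. Qed.

Lemma sum1_plus (h g : nat -> R) (N : nat) : sum1 (fun n => h n + g n) N = sum1 h N + sum1 g N.
Proof. induction N as [|N IH]; simpl; [ring|rewrite IH; ring]. Qed.

Lemma sum1_scal (c : R) (h : nat -> R) (N : nat) : sum1 (fun n => c * h n) N = c * sum1 h N.
Proof. induction N as [|N IH]; simpl; [ring|rewrite IH; ring]. Qed.

Definition helm (n : nat) : R := / (1 + INR n ^ 2).

Lemma helm_pos (n : nat) : 0 < helm n.
Proof. apply Rinv_0_lt_compat. generalize (pow2_ge_0 (INR n)); lra. Qed.

(** The induction carries a telescoping bound, from 1/(1 + y^2) <= 2/(y (y + 1)) = 2/y - 2/(y +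
    1). *)
Lemma sum1_helm_le (N : nat) : sum1 helm N <= 2.
Proof.
assert (H : sum1 helm N <= 2 - 2 / INR (S N)).
{ induction N as [|N IH]; [simpl; lra|].
  change (sum1 helm N + / (1 + INR (S N) ^ 2) <= 2 - 2 / INR (S (S N))).
  rewrite (S_INR (S N)). set (y := INR (S N)) in *.
  assert (Hy : 1 <= y) by (unfold y; rewrite S_INR; generalize (pos_INR N); lra).
  enough (/ (1 + y ^ 2) <= 2 / y - 2 / (y + 1)) by lra.
  replace (2 / y - 2 / (y + 1)) with (/ ((y * (y + 1)) / 2)) by (field; lra).
  apply Rinv_le_contravar; [|generalize (pow2_ge_0 (y - 1)); lra].
  apply Rdiv_lt_0_compat; [apply Rmult_lt_0_compat|]; lra. }
assert (0 < / INR (S N)) by (apply Rinv_0_lt_compat, lt_0_INR; lia).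
unfold Rdiv in H; lra.
Qed.

(** The even kernel with Fourier coefficients [a]: the Dirichlet kernel for [a = 1], the truncated
    Green kernel for [a = helm]. *)
Fixpoint tri (a : nat -> R) (N : nat) (z : R) : R :=
  match N with O => a O | S m => tri a m z + 2 * a (S m) * cos (INR (S m) * z) end.

Fixpoint psum (a : nat -> R) (f : R -> R) (N : nat) (x : R) : R :=
  match N with
  | O => a O * mean f
  | S m => psum a f m x
           + 2 * a (S m) * (fcos f (INR (S m)) * cos (INR (S m) * x) + fsin f (INR (S m)) * sin (INR (S m) * x))
  end.

Lemma cont_tri (a : nat -> R) (N : nat) (g : R -> R) : cont g -> cont (fun y => tri a N (g y)).
Proof. intros Hg; induction N as [|N IH]; cbn [tri]; ct. Qed.

(** Bridge from sums of modes to integrals against a kernel, through which bounds on the kernel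
    become bounds on the sums. *)
Lemma psum_tri (a : nat -> R) (f : R -> R) (N : nat) (x : R) : cont f ->
  psum a f N x = mean (fun y => f y * tri a N (y - x)).
Proof.
intros Hf; induction N as [|N IH]; cbn [psum tri].
- rewrite <- mean_scal by exact Hf. apply mean_ext; intros y; ring.
- rewrite IH. unfold fcos, fsin. set (w := INR (S N)).
  rewrite (Rmult_comm _ (cos (w * x))), (Rmult_comm _ (sin (w * x))).
  assert (cont (fun y => tri a N (y - x))) by (apply cont_tri; ct).
  rewrite <- !mean_scal, <- mean_plus, <- mean_scal, <- mean_plus by ct.
  apply mean_ext; intros y. rewrite (Rmult_minus_distr_l w y x), cos_minus. ring.
Qed.

Lemma mean_cos_shift (n : nat) (x : R) : mean (fun y => cos (INR (S n) * (y - x))) = 0.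
Proof.
unfold Rminus; rewrite (mean_shift (fun y => cos (INR (S n) * y)) (- x)); [|ct|apply cos_period_INR].
rewrite INR_IZR_INZ. apply mean_cos_Z. lia.
Qed.

Lemma mean_tri (a : nat -> R) (N : nat) (x : R) : mean (fun y => tri a N (y - x)) = a O.
Proof.
induction N as [|N IH]; cbn [tri]; [apply mean_const|].
rewrite mean_plus; [|apply cont_tri; ct|ct].
rewrite IH, mean_scal by ct. rewrite mean_cos_shift; ring.
Qed.

Definition dirichlet (j : nat) (z : R) : R := tri (fun _ => 1) j z.
(** Left unnormalized: a sum, not an average, of Dirichlet kernels, so its mean is N + 1. *)
Definition fejer (N : nat) (z : R) : R := sum_f_R0 (fun j => dirichlet j z) N.

(** Multiplying by 1 - cos z instead of dividing by sin (z/2) avoids half angles, and the right-hand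
    sides telescope when summed over [j]. *)
Lemma dirichlet_eq (j : nat) (z : R) :
  (1 - cos z) * dirichlet j z = cos (INR j * z) - cos (INR (S j) * z).
Proof.
unfold dirichlet; induction j as [|j IH]; cbn [tri].
- simpl. rewrite Rmult_0_l, cos_0, Rmult_1_l; ring.
- rewrite Rmult_plus_distr_l, IH.
  rewrite (S_INR (S j)). replace (INR j) with (INR (S j) - 1) by (rewrite S_INR; ring).
  set (w := INR (S j)).
  rewrite Rmult_minus_distr_r, Rmult_plus_distr_r, Rmult_1_l, cos_minus, cos_plus. ring.
Qed.

Lemma fejer_eq (N : nat) (z : R) : (1 - cos z) * fejer N z = 1 - cos (INR (S N) * z).
Proof.
unfold fejer; induction N as [|N IH].
- simpl sum_f_R0. rewrite dirichlet_eq. simpl. now rewrite Rmult_0_l, cos_0.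
- rewrite tech5, Rmult_plus_distr_l, IH, dirichlet_eq. ring.
Qed.

(** Covers the points where [fejer_eq] degenerates to 0 = 0; there every cosine in the kernel equals
    1. *)
Lemma dirichlet_at_period (j : nat) (z : R) : cos z = 1 -> 0 <= dirichlet j z.
Proof.
intros Hz.
assert (Hs : sin z = 0) by (generalize (sin2_cos2 z); rewrite Hz; unfold Rsqr; intros; nra).
assert (Hn : forall n, cos (INR n * z) = 1).
{ induction n as [|n IH]; [simpl; now rewrite Rmult_0_l, cos_0|].
  rewrite S_INR, Rmult_plus_distr_r, Rmult_1_l, cos_plus, Hz, Hs, IH; ring. }
unfold dirichlet; induction j as [|j IH]; cbn [tri]; [lra|]. rewrite Hn; lra.
Qed.

Lemma fejer_nonneg (N : nat) (z : R) : 0 <= fejer N z.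
Proof.
generalize (COS_bound z); intros [_ Hz].
destruct (Req_dec (cos z) 1) as [H|H].
- unfold fejer. apply cond_pos_sum; intros; now apply dirichlet_at_period.
- generalize (fejer_eq N z) (COS_bound (INR (S N) * z)); intros E B.
  assert (0 < 1 - cos z) by lra. nra.
Qed.

Lemma cont_fejer (N : nat) (g : R -> R) : cont g -> cont (fun y => fejer N (g y)).
Proof.
intros Hg; unfold fejer; induction N as [|N IH]; cbn [sum_f_R0]; unfold dirichlet.
- now apply cont_tri.
- apply cont_plus; [exact IH | now apply cont_tri].
Qed.

Lemma mean_fejer (N : nat) (x : R) : mean (fun y => fejer N (y - x)) = INR (S N).
Proof.
unfold fejer; induction N as [|N IH].
- cbn [sum_f_R0]; unfold dirichlet; now rewrite mean_tri.
- cbn [sum_f_R0]. rewrite mean_plus, IH.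
  + unfold dirichlet; rewrite mean_tri. now rewrite (S_INR (S N)).
  + apply (cont_fejer N (fun y => y - x)); ct.
  + apply cont_tri; ct.
Qed.

Lemma sum_psum_fejer (f : R -> R) (N : nat) (x : R) : cont f ->
  sum_f_R0 (fun j => psum (fun _ => 1) f j x) N = mean (fun y => f y * fejer N (y - x)).
Proof.
intros Hf; unfold fejer; induction N as [|N IH]; cbn [sum_f_R0].
- now rewrite psum_tri.
- rewrite IH, psum_tri, <- mean_plus.
  + apply mean_ext; intros y; unfold dirichlet; ring.
  + apply cont_mult; [exact Hf|]. apply (cont_fejer N (fun y => y - x)); ct.
  + apply cont_mult; [exact Hf|]. apply cont_tri; ct.
  + exact Hf.
Qed.

(** The error is measured by 1 - cos (y - x) because the Fejer kernel times this factor is bounded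
    ([fejer_eq]); the integral then need not be split into near and far parts. *)
Lemma cont_periodic_modulus (f : R -> R) (x e : R) : cont f -> periodic f -> 0 < e ->
  exists C, 0 <= C /\ forall y, Rabs (f y - f x) <= e + C * (1 - cos (y - x)).
Proof.
intros Hc Hp He. assert (HP := PI_RGT_0).
destruct (cont_periodic_bounded f Hc Hp) as [M [HM0 HM]].
destruct (cont_eps f x e Hc He) as [d0 [Hd0 H0]].
pose (d := Rmin d0 PI).
assert (Hd : 0 < d) by (apply Rmin_glb_lt; lra).
assert (Hd1 : d <= d0) by apply Rmin_l.
assert (Hd2 : d <= PI) by apply Rmin_r.
assert (Hcd : cos d < 1) by (rewrite <- cos_0; apply cos_decreasing_1; lra).
(* At distance at least [d] from [x] modulo 2 PI, 1 - cos (y - x) >= 1 - cos d, so this constant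
   makes the second term at least 2 M, which bounds the oscillation of [f]. *)
exists (2 * M / (1 - cos d)).
assert (HC : 0 <= 2 * M / (1 - cos d)).
{ apply Rmult_le_pos; [lra | left; apply Rinv_0_lt_compat; lra]. }
split; [exact HC|]. intros y.
destruct (periodic_reduce (y - x + PI)) as [k Hk].
pose (z := y - x + 2 * PI * IZR k).
assert (Hz : - PI <= z <= PI) by (unfold z; lra).
assert (Ec : cos (y - x) = cos z).
{ unfold z; symmetry; apply (periodic_Z cos). intros w; rewrite cos_plus, cos_2PI, sin_2PI; ring. }
assert (Ef : f y = f (x + z)).
{ rewrite <- (periodic_Z f k y Hp). f_equal; unfold z; ring. }
rewrite Ec, Ef. generalize (COS_bound z); intros [_ B1].
destruct (Rlt_le_dec (Rabs z) d) as [Hlt|Hge].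
- assert (Rabs (f (x + z) - f x) < e).
  { apply H0. replace (x + z - x) with z by ring. lra. }
  assert (0 <= 2 * M / (1 - cos d) * (1 - cos z)) by (apply Rmult_le_pos; lra). lra.
- assert (Hcz : cos z <= cos d).
  { replace (cos z) with (cos (Rabs z)).
    - apply cos_decr_1; try lra; try apply Rabs_pos. apply Rabs_le; lra.
    - unfold Rabs; destruct (Rcase_abs z); [apply cos_neg|reflexivity]. }
  apply Rle_trans with (2 * M).
  + generalize (HM (x + z)) (HM x) (Rabs_triang (f (x + z)) (- f x)).
    rewrite Rabs_Ropp; unfold Rminus; lra.
  + apply Rle_trans with (2 * M / (1 - cos d) * (1 - cos d)).
    * right; field; lra.
    * assert (2 * M / (1 - cos d) * (1 - cos d) <= 2 * M / (1 - cos d) * (1 - cos z))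
        by (apply Rmult_le_compat_l; lra). lra.
Qed.

(** The average of the first N + 1 partial sums inherits the bound [B] and differs from f(x) by at
    most e/2 + 2 C/(N + 1). Convergence of the partial sums is not assumed. *)
Lemma fejer_bound (f : R -> R) (x B : R) : cont f -> periodic f ->
  (forall N, Rabs (psum (fun _ => 1) f N x) <= B) -> Rabs (f x) <= B.
Proof.
intros Hc Hp HB. apply le_epsilon; intros e He.
destruct (cont_periodic_modulus f x (e / 2) Hc Hp ltac:(lra)) as [C [HC0 HC]].
assert (Hk : forall N, cont (fun y => fejer N (y - x))).
{ intros N; apply (cont_fejer N (fun y => y - x)); ct. }
assert (HN : forall N, INR (S N) * Rabs (f x) <= INR (S N) * (B + e / 2) + 2 * C).
{ intros N. pose (nn := INR (S N)). assert (Hn : 0 < nn) by (apply lt_0_INR; lia).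
  fold nn.
  assert (E : nn * f x = sum_f_R0 (fun j => psum (fun _ => 1) f j x) N
              - mean (fun y => (f y - f x) * fejer N (y - x))).
  { rewrite sum_psum_fejer by exact Hc. unfold nn; rewrite <- (mean_fejer N x).
    rewrite (Rmult_comm _ (f x)), <- mean_scal, <- mean_minus; [|try apply (Hk N) ..].
    - apply mean_ext; intros y; ring.
    - apply cont_mult; [exact Hc|apply Hk].
    - apply (cont_mult (fun y => f y - f x)); [ct|apply Hk]. }
  assert (E2 : Rabs (mean (fun y => (f y - f x) * fejer N (y - x))) <= e / 2 * nn + 2 * C).
  { apply Rle_trans with (mean (fun y => e / 2 * fejer N (y - x) + 2 * C)).
    - apply mean_abs_le.
      + apply (cont_mult (fun y => f y - f x)); [ct|apply Hk].
      + apply cont_plus; [apply cont_mult; [ct|apply Hk]|ct].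
      + intros y. rewrite Rabs_mult, (Rabs_pos_eq (fejer _ _)) by apply fejer_nonneg.
        apply Rle_trans with ((e / 2 + C * (1 - cos (y - x))) * fejer N (y - x)).
        * apply Rmult_le_compat_r; [apply fejer_nonneg | apply HC].
        (* The kernel absorbs 1 - cos (y - x), leaving C (1 - cos ((N + 1)(y - x))) <= 2 C. *)
        * rewrite Rmult_plus_distr_r, Rmult_assoc, fejer_eq.
          generalize (COS_bound (INR (S N) * (y - x))); intros. nra.
    - rewrite mean_plus, mean_scal, mean_const, mean_fejer; [fold nn; lra|apply Hk| |ct].
      apply cont_mult; [ct|apply Hk]. }
  assert (E1 : Rabs (sum_f_R0 (fun j => psum (fun _ => 1) f j x) N) <= nn * B).
  { unfold nn; clear - HB. induction N as [|N IH].
    - cbn [sum_f_R0]. change (INR 1) with 1. generalize (HB O); lra.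
    - rewrite tech5. eapply Rle_trans; [apply Rabs_triang|].
      rewrite (S_INR (S N)). generalize (HB (S N)); lra. }
  rewrite <- (Rabs_pos_eq nn) at 1 by lra. rewrite <- Rabs_mult, E.
  eapply Rle_trans; [apply (Rabs_triang _ (- _))|]. rewrite Rabs_Ropp. lra. }
destruct (Rle_lt_dec (Rabs (f x)) (B + e)) as [|Hlt]; auto. exfalso.
(* If |f(x)| > B + e, then [HN n] forces (n + 1) e/2 < 2 C, which fails once n e > 4 (C + 1). *)
destruct (archimed_cor1 (e / (4 * (C + 1)))) as [n [Hn1 Hn2]].
{ apply Rdiv_lt_0_compat; lra. }
assert (Hn : 0 < INR n) by now apply lt_0_INR.
assert (4 * (C + 1) < INR n * e).
{ apply (Rmult_lt_compat_l (INR n * (4 * (C + 1)))) in Hn1; [|apply Rmult_lt_0_compat; lra].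
  replace (INR n * (4 * (C + 1)) * / INR n) with (4 * (C + 1)) in Hn1 by (field; lra).
  replace (INR n * (4 * (C + 1)) * (e / (4 * (C + 1)))) with (INR n * e) in Hn1 by (field; lra).
  exact Hn1. }
generalize (HN n). rewrite S_INR. nra.
Qed.

(** * Orthogonality relations and Bessel's inequality *)

Lemma orth_cos (m n : nat) : (m < n)%nat ->
  mean (fun x => cos (INR m * x) * cos (INR n * x)) = 0 /\
  mean (fun x => sin (INR m * x) * sin (INR n * x)) = 0.
Proof.
intros H. rewrite !INR_IZR_INZ, mean_cos_cos, mean_sin_sin, !mean_cos_Z by lia. split; ring.
Qed.

Lemma orth_sin_cos (m n : nat) : mean (fun x => sin (INR m * x) * cos (INR n * x)) = 0.
Proof. rewrite !INR_IZR_INZ; apply mean_sin_cos. Qed.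

Lemma mean_cos_sqr (n : nat) : (0 < n)%nat ->
  mean (fun x => cos (INR n * x) * cos (INR n * x)) = / 2 /\
  mean (fun x => sin (INR n * x) * sin (INR n * x)) = / 2.
Proof.
intros H. rewrite !INR_IZR_INZ, mean_cos_cos, mean_sin_sin, Z.sub_diag.
rewrite (mean_cos_Z (Z.of_nat n + Z.of_nat n)) by lia.
rewrite (mean_ext (fun x => cos (0 * x)) (fun _ => 1)), mean_const; [split; field|].
intros x; now rewrite Rmult_0_l, cos_0.
Qed.

(** What remains of [g] after removing the modes 1 to N. The mean is kept, since Bessel's inequality
    is wanted for the modes n >= 1 alone. *)
Fixpoint frem (g : R -> R) (N : nat) (x : R) : R :=
  match N with
  | O => g x
  | S m => frem g m x - 2 * (fcos g (INR (S m)) * cos (INR (S m) * x) + fsin g (INR (S m)) * sin (INR (S m) * x))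
  end.

Lemma cont_frem (g : R -> R) (N : nat) : cont g -> cont (frem g N).
Proof.
intros Hg; induction N as [|N IH]; [exact Hg|].
change (cont (fun x => frem g N x - 2 * (fcos g (INR (S N)) * cos (INR (S N) * x)
  + fsin g (INR (S N)) * sin (INR (S N) * x)))). ct.
Qed.

Lemma frem_coef (g : R -> R) (N p : nat) : cont g -> (N < p)%nat ->
  fcos (frem g N) (INR p) = fcos g (INR p) /\ fsin (frem g N) (INR p) = fsin g (INR p).
Proof.
intros Hg; induction N as [|N IH]; intros Hp; [split; reflexivity|].
destruct IH as [IH1 IH2]; [lia|]. assert (HR := cont_frem g N Hg).
destruct (orth_cos (S N) p Hp) as [O1 O2].
assert (O3 := orth_sin_cos (S N) p). assert (O4 := orth_sin_cos p (S N)).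
rewrite <- IH1, <- IH2. unfold fcos at 1, fsin at 1; cbn [frem].
set (a := fcos g (INR (S N))); set (b := fsin g (INR (S N))); set (w := INR (S N)) in *; set (q := INR p) in *.
split.
- rewrite (mean_ext _ (fun x => frem g N x * cos (q * x)
    - ((2 * a) * (cos (w * x) * cos (q * x)) + (2 * b) * (sin (w * x) * cos (q * x))))) by (intros; ring).
  rewrite mean_minus, mean_plus, !mean_scal, O1, O3 by ct. unfold fcos; ring.
- rewrite (mean_ext _ (fun x => frem g N x * sin (q * x)
    - ((2 * a) * (sin (q * x) * cos (w * x)) + (2 * b) * (sin (w * x) * sin (q * x))))) by (intros; ring).
  rewrite mean_minus, mean_plus, !mean_scal, O2, O4 by ct. unfold fsin; ring.
Qed.

(** Removing one more mode with coefficients a, b changes the mean square by -4 (a^2 + b^2) from the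
    cross terms and +2 (a^2 + b^2) from the squares. *)
Lemma bessel_eq (g : R -> R) (N : nat) : cont g ->
  mean (fun x => frem g N x * frem g N x) =
  mean (fun x => g x * g x) - 2 * sum1 (fun n => fcos g (INR n) ^ 2 + fsin g (INR n) ^ 2) N.
Proof.
intros Hg; induction N as [|N IH]; cbn [sum1 frem]; [ring|].
assert (HR := cont_frem g N Hg).
destruct (frem_coef g N (S N) Hg ltac:(lia)) as [F1 F2].
destruct (mean_cos_sqr (S N) ltac:(lia)) as [C1 C2]. assert (C3 := orth_sin_cos (S N) (S N)).
set (w := INR (S N)) in *. set (a := fcos g w) in *; set (b := fsin g w) in *.
unfold fcos in F1; unfold fsin in F2.
rewrite (mean_ext _ (fun x => frem g N x * frem g N x
  - (4 * a * (frem g N x * cos (w * x)) + 4 * b * (frem g N x * sin (w * x)))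
  + (4 * a ^ 2 * (cos (w * x) * cos (w * x)) + 4 * b ^ 2 * (sin (w * x) * sin (w * x))
     + 8 * a * b * (sin (w * x) * cos (w * x))))) by (intros; ring).
rewrite mean_plus, mean_minus, !mean_plus, !mean_scal, IH, F1, F2, C1, C2, C3 by ct.
field.
Qed.

Lemma bessel (g : R -> R) (N : nat) : cont g ->
  2 * sum1 (fun n => fcos g (INR n) ^ 2 + fsin g (INR n) ^ 2) N <= mean (fun x => g x * g x).
Proof.
intros Hg. assert (HR := cont_frem g N Hg).
assert (0 <= mean (fun x => frem g N x * frem g N x)).
{ rewrite <- (mean_const 0). apply mean_mono; [ct|ct|]. intros; nra. }
rewrite bessel_eq in H by exact Hg. lra.
Qed.

(** * Positivity of the Green operator *)

(** With m = n + 1 >= 1 the numerator is 6 m^2 - 4 > 0. At n = 0 the second difference is 1 - 2/2 +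
    1/5 = 1/5. *)
Lemma helm_convex (n : nat) : 0 <= helm n - 2 * helm (S n) + helm (S (S n)).
Proof.
unfold helm; rewrite !S_INR. set (y := INR n). assert (Hy : 0 <= y) by apply pos_INR. clearbody y.
replace (/ (1 + y ^ 2) - 2 * / (1 + (y + 1) ^ 2) + / (1 + (y + 1 + 1) ^ 2))
  with ((6 * (y + 1) ^ 2 - 4) / ((1 + y ^ 2) * (1 + (y + 1) ^ 2) * (1 + (y + 1 + 1) ^ 2))).
- apply Rmult_le_pos; [nra|]. left; apply Rinv_0_lt_compat.
  repeat apply Rmult_lt_0_compat; nra.
- field; repeat split; nra.
Qed.

Lemma helm_decr (n : nat) : helm (S n) <= helm n.
Proof.
unfold helm; rewrite S_INR. generalize (pos_INR n); intros.
apply Rinv_le_contravar; nra.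
Qed.

(** Crude but enough: [helm j] decays like 1/j^2, so the boundary term [helm j * dirichlet j]
    vanishes in the limit. *)
Lemma dirichlet_abs (j : nat) (z : R) : Rabs (dirichlet j z) <= 2 * INR j + 1.
Proof.
unfold dirichlet; induction j as [|j IH]; cbn [tri].
- rewrite Rabs_R1; simpl; lra.
- rewrite S_INR. eapply Rle_trans; [apply Rabs_triang|].
  assert (Rabs (2 * 1 * cos (INR (S j) * z)) <= 2).
  { rewrite S_INR. apply Rabs_le. generalize (COS_bound ((INR j + 1) * z)); lra. }
  rewrite S_INR in H. lra.
Qed.

(* Two summations by parts write the kernel as a nonnegative combination of Fejer kernels, because
   [helm] is convex; the constant 1/5 is the coefficient of the Fejer kernel of order 0. *)
Lemma tri_helm_lower (N : nat) (z : R) :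
  / 5 - helm (S (S N)) * (2 * INR (S (S N)) + 1) <= tri helm (S (S N)) z.
Proof.
assert (Hs : forall a n, tri a (S n) z = a n * dirichlet (S n) z - a n * dirichlet n z + (tri a n z)
   - (a n - a (S n)) * (dirichlet (S n) z - dirichlet n z)).
{ intros a n. unfold dirichlet; cbn [tri]; ring. }
(* After the two boundary terms are subtracted, there remains the sum over j <= n of the second
   difference of [helm] at j times [fejer j]; its term j = 0 is 1/5 and the others are
   nonnegative. *)
assert (H : forall n, / 5 <= tri helm (S (S n)) z - helm (S (S n)) * dirichlet (S (S n)) z
   - (helm (S n) - helm (S (S n))) * fejer (S n) z).
{ induction n as [|n IH].
  - unfold fejer, dirichlet; cbn [tri sum_f_R0]. unfold helm; simpl INR. simpl. lra.
  - rewrite (Hs helm (S (S n))).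
    assert (Hf : fejer (S (S n)) z = fejer (S n) z + dirichlet (S (S n)) z) by reflexivity.
    assert (0 <= (helm (S n) - 2 * helm (S (S n)) + helm (S (S (S n)))) * fejer (S n) z)
      by (apply Rmult_le_pos; [apply helm_convex|apply fejer_nonneg]).
    rewrite Hf. lra. }
assert (H1 : 0 <= (helm (S N) - helm (S (S N))) * fejer (S N) z).
{ apply Rmult_le_pos; [generalize (helm_decr (S N)); lra|apply fejer_nonneg]. }
assert (H2 : helm (S (S N)) * - dirichlet (S (S N)) z <= helm (S (S N)) * (2 * INR (S (S N)) + 1)).
{ apply Rmult_le_compat_l; [left; apply helm_pos|].
  generalize (dirichlet_abs (S (S N)) z) (Rle_abs (- dirichlet (S (S N)) z)). rewrite Rabs_Ropp. lra. }
generalize (H N); lra.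
Qed.

Lemma psum_helm_lower (f : R -> R) (N : nat) (x : R) : cont f -> (forall y, 0 <= f y) ->
  (/ 5 - helm (S (S N)) * (2 * INR (S (S N)) + 1)) * mean f <= psum helm f (S (S N)) x.
Proof.
intros Hc Hp. rewrite psum_tri by exact Hc. rewrite <- mean_scal by exact Hc.
apply mean_mono; [ct|apply cont_mult; [exact Hc|apply cont_tri; ct]|].
intros y. rewrite (Rmult_comm (f y)). apply Rmult_le_compat_r; [apply Hp|apply tri_helm_lower].
Qed.

Lemma sum_n_sum1 (h : nat -> R) (N : nat) : sum_n (fun n => h (S n)) N = sum1 h (S N).
Proof.
induction N as [|N IH]; [rewrite sum_O; simpl; ring|].
rewrite sum_Sn, IH. reflexivity.
Qed.

Lemma ex_series_bounded (a : nat -> R) (M : R) : (forall n, 0 <= a n) ->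
  (forall N, sum_n a N <= M) -> ex_series a.
Proof.
intros Hp HM. destruct (ex_finite_lim_seq_incr (sum_n a) M) as [l Hl].
- intros n; rewrite sum_Sn; unfold plus; simpl. generalize (Hp (S n)); lra.
- exact HM.
- exists l; exact Hl.
Qed.

Lemma ex_series_helm_S : ex_series (fun n => helm (S n)).
Proof.
apply (ex_series_bounded _ 2); [intros; left; apply helm_pos|].
intros N; rewrite sum_n_sum1; apply sum1_helm_le.
Qed.

Lemma fcos_abs (f : R -> R) (M w : R) : cont f -> (forall x, Rabs (f x) <= M) -> Rabs (fcos f w) <= M.
Proof.
intros Hc HM. apply mean_abs_le_const; [ct|]. intros x. rewrite Rabs_mult.
generalize (HM x) (Rabs_pos (f x)) (Rabs_pos (cos (w * x))); intros.
assert (Rabs (cos (w * x)) <= 1) by apply Rabs_le, COS_bound. nra.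
Qed.

Lemma fsin_abs (f : R -> R) (M w : R) : cont f -> (forall x, Rabs (f x) <= M) -> Rabs (fsin f w) <= M.
Proof.
intros Hc HM. apply mean_abs_le_const; [ct|]. intros x. rewrite Rabs_mult.
generalize (HM x) (Rabs_pos (f x)) (Rabs_pos (sin (w * x))); intros.
assert (Rabs (sin (w * x)) <= 1) by apply Rabs_le, SIN_bound. nra.
Qed.

Lemma fcos_opp (f : R -> R) (w : R) : fcos f (- w) = fcos f w.
Proof.
apply mean_ext; intros x. rewrite <- (cos_neg (w * x)). do 2 f_equal; ring.
Qed.

Lemma fsin_opp (f : R -> R) (w : R) : cont f -> fsin f (- w) = - fsin f w.
Proof.
intros Hc; unfold fsin. rewrite <- mean_opp by ct. apply mean_ext; intros x.
replace (- w * x) with (- (w * x)) by ring. rewrite sin_neg; ring.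
Qed.

Lemma fcos_0 (f : R -> R) : fcos f 0 = mean f.
Proof. apply mean_ext; intros x; rewrite Rmult_0_l, cos_0; ring. Qed.

Lemma fsin_0 (f : R -> R) : fsin f 0 = 0.
Proof.
unfold fsin; rewrite (mean_ext _ (fun _ => 0)); [apply mean_const|].
intros x; rewrite Rmult_0_l, sin_0; ring.
Qed.

(** * The inverse Helmholtz operator as a limit of kernel sums *)

Lemma inv_helmholtz_term (f : R -> R) (k : Z) (x : R) :
  Re (Cmult (RtoC (/ (1 + IZR k ^ 2))) (Cmult (fourier f k) (cis (IZR k * x)))) =
  / (1 + IZR k ^ 2) * (fcos f (IZR k) * cos (IZR k * x) + fsin f (IZR k) * sin (IZR k * x)).
Proof. unfold fcos, fsin, mean, fourier, cis, Cmult, RtoC, Re; simpl; ring. Qed.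

(** The cosine coefficient is even and the sine coefficient odd in k, so the terms k and -k agree
    and the two-sided series folds into the mean plus twice a one-sided series. The latter converges
    because the coefficients are bounded by sup |f| and [helm] is summable. *)
Lemma inv_helmholtz_lim (f : R -> R) (x : R) : cont f -> periodic f ->
  is_lim_seq (fun N => psum helm f (S N) x) (inv_helmholtz f x).
Proof.
intros Hc Hp.
set (T := fun n : nat => helm n * (fcos f (INR n) * cos (INR n * x) + fsin f (INR n) * sin (INR n * x))).
destruct (cont_periodic_bounded f Hc Hp) as [M [HM0 HM]].
assert (HT : ex_series (fun n => T (S n))).
{ apply (ex_series_le (K := R_AbsRing) (V := R_CompleteNormedModule) _ (fun n => 2 * M * helm (S n))).
  - intros n. change (Rabs (T (S n)) <= 2 * M * helm (S n)). unfold T.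
    generalize (helm_pos (S n)); intros Hh.
    rewrite Rabs_mult, (Rabs_pos_eq (helm _)), Rmult_comm by lra. apply Rmult_le_compat_r; [lra|].
    eapply Rle_trans; [apply Rabs_triang|]. rewrite !Rabs_mult.
    set (w := INR (S n)).
    generalize (fcos_abs f M w Hc HM) (fsin_abs f M w Hc HM) (Rabs_pos (fcos f w)) (Rabs_pos (fsin f w))
      (Rabs_pos (cos (w * x))) (Rabs_pos (sin (w * x))).
    assert (Rabs (cos (w * x)) <= 1) by apply Rabs_le, COS_bound.
    assert (Rabs (sin (w * x)) <= 1) by apply Rabs_le, SIN_bound. intros. nra.
  - apply (ex_series_scal (K := R_AbsRing) (V := R_NormedModule)). apply ex_series_helm_S. }
assert (E : inv_helmholtz f x = mean f + 2 * Series (fun n => T (S n))).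
{ unfold inv_helmholtz, SeriesZ.
  transitivity (Series T + Series (fun n => T (S n))).
  - f_equal; apply Series_ext; intros n; rewrite inv_helmholtz_term.
    + rewrite <- INR_IZR_INZ. reflexivity.
    + rewrite opp_IZR, <- INR_IZR_INZ. unfold T, helm.
      rewrite fcos_opp, fsin_opp by exact Hc. set (w := INR (S n)).
      rewrite Ropp_mult_distr_l_reverse, cos_neg, sin_neg.
      replace ((- w) ^ 2) with (w ^ 2) by ring. ring.
  - rewrite (Series_incr_1 T) by now apply (ex_series_incr_1 T).
    unfold T at 1; unfold helm; simpl INR. rewrite fcos_0, fsin_0, (Rmult_0_l x), cos_0, sin_0. field. }
rewrite E.
apply (is_lim_seq_ext (fun N => mean f + 2 * sum_n (fun n => T (S n)) N)).
- intros N. rewrite sum_n_sum1. generalize (S N); intros m. induction m as [|m IH]; cbn [psum sum1].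
  + unfold helm; simpl; field.
  + rewrite <- IH; unfold T; ring.
- apply (is_lim_seq_plus' (fun _ => mean f)); [apply is_lim_seq_const|].
  apply (is_lim_seq_scal_l (fun N => sum_n (fun n => T (S n)) N) 2 (Series (fun n => T (S n)))).
  exact (Series_correct _ HT).
Qed.

(** Each truncated kernel has mean [helm 0 = 1], so the shift by [c] is exact already for the
    partial sums. *)
Lemma inv_helmholtz_minus_const (f : R -> R) (c x : R) : cont f -> periodic f ->
  inv_helmholtz (fun y => f y - c) x = inv_helmholtz f x - c.
Proof.
intros Hc Hp.
assert (L1 := inv_helmholtz_lim (fun y => f y - c) x ltac:(ct) ltac:(intros y; now rewrite Hp)).
assert (L2 := inv_helmholtz_lim f x Hc Hp).
assert (L3 : is_lim_seq (fun N => psum helm (fun y => f y - c) (S N) x) (inv_helmholtz f x - c)).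
{ apply (is_lim_seq_ext (fun N => psum helm f (S N) x - c)).
  - intros N. rewrite !psum_tri by ct.
    assert (Ht : cont (fun y => tri helm (S N) (y - x))) by (apply cont_tri; ct).
    replace c with (c * mean (fun y => tri helm (S N) (y - x))) at 1.
    + rewrite <- mean_scal, <- mean_minus by ct. apply mean_ext; intros; ring.
    + rewrite mean_tri. unfold helm; simpl; field.
  - apply (is_lim_seq_minus' _ (fun _ => c)); [exact L2|apply is_lim_seq_const]. }
apply is_lim_seq_unique in L1; apply is_lim_seq_unique in L3.
rewrite L1 in L3. now injection L3.
Qed.

Lemma mean_le_inv_helmholtz (f : R -> R) (x : R) : cont f -> periodic f -> (forall y, 0 <= f y) ->
  / 5 * mean f <= inv_helmholtz f x.
Proof.
intros Hc Hp Hpos.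
assert (L := inv_helmholtz_lim f x Hc Hp). apply is_lim_seq_incr_1 in L.
apply (is_lim_seq_le (fun N => (/ 5 - helm (S (S N)) * (2 * INR (S (S N)) + 1)) * mean f)
  (fun N => psum helm f (S (S N)) x) (/ 5 * mean f) (inv_helmholtz f x)); [|clear L|exact L].
- intros N; now apply psum_helm_lower.
- apply (is_lim_seq_scal_r _ (mean f) (/ 5)).
  replace (Finite (/ 5)) with (Finite (/ 5 - 0)) by (f_equal; ring).
  apply is_lim_seq_minus'; [apply is_lim_seq_const|].
  (* With y = N + 1 the boundary term is (2 y + 3)/(1 + (y + 1)^2), which is at most 3/y. *)
  apply (is_lim_seq_le_le (fun _ => 0) _ (fun N => 3 * / INR (S N))).
  + intros N. assert (0 < INR (S N)) by (apply lt_0_INR; lia).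
    split; [apply Rmult_le_pos; [left; apply helm_pos|rewrite S_INR; lra]|].
    unfold helm. rewrite (S_INR (S N)). set (y := INR (S N)) in *.
    assert (1 <= y) by (unfold y; rewrite S_INR; generalize (pos_INR N); lra). clearbody y.
    apply (Rmult_le_reg_r (y * (1 + (y + 1) ^ 2))); [apply Rmult_lt_0_compat; nra|].
    replace (/ (1 + (y + 1) ^ 2) * (2 * (y + 1) + 1) * (y * (1 + (y + 1) ^ 2))) with ((2 * (y + 1) + 1) * y) by (field; nra).
    replace (3 * / y * (y * (1 + (y + 1) ^ 2))) with (3 * (1 + (y + 1) ^ 2)) by (field; nra). nra.
  + apply is_lim_seq_const.
  + replace (Finite 0) with (Rbar_mult 3 0) by (simpl; f_equal; ring).
    apply (is_lim_seq_scal_l (fun N => / INR (S N)) 3 0).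
    apply (is_lim_seq_incr_1 (fun n => / INR n)).
    apply (is_lim_seq_inv _ p_infty); [apply is_lim_seq_INR|discriminate].
Qed.

Lemma flux_square (a : R) : a + / 2 * a ^ 2 = / 2 * (1 + a) ^ 2 - / 2.
Proof. field. Qed.

Lemma inv_helmholtz_flux_rigid (f : R -> R) (x : R) : cont f -> periodic f ->
  inv_helmholtz (fun y => f y + / 2 * f y ^ 2) x = - (1 / 2) -> forall y, f y = -1.
Proof.
intros Hc Hp H y.
replace (fun y => f y + / 2 * f y ^ 2) with (fun y => / 2 * (1 + f y) ^ 2 - / 2) in H
  by (apply functional_extensionality; intros; symmetry; apply flux_square).
assert (Hc' : cont (fun y => / 2 * (1 + f y) ^ 2)) by ct.
assert (Hp' : periodic (fun y => / 2 * (1 + f y) ^ 2)) by (intros z; now rewrite Hp).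
assert (Hq : forall y, 0 <= / 2 * (1 + f y) ^ 2) by (intros z; generalize (pow2_ge_0 (1 + f z)); lra).
rewrite inv_helmholtz_minus_const in H by assumption.
assert (Hm := mean_le_inv_helmholtz _ x Hc' Hp' Hq).
assert (Hz := mean_eq_0 _ Hc' Hp' Hq ltac:(lra) y). cbv beta in Hz. nra.
Qed.

(** * The space H^1 *)

Lemma H1_weight_eq (f : R -> R) (k : Z) :
  H1_weight f k = (1 + IZR k ^ 2) * (fcos f (IZR k) ^ 2 + fsin f (IZR k) ^ 2).
Proof.
unfold H1_weight, Cmod. rewrite pow2_sqrt.
- unfold fourier, fcos, fsin, mean; simpl; ring.
- apply Rplus_le_le_0_compat; apply pow2_ge_0.
Qed.

Lemma H1_weight_nonneg (f : R -> R) (k : Z) : 0 <= H1_weight f k.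
Proof.
rewrite H1_weight_eq. generalize (pow2_ge_0 (IZR k)) (pow2_ge_0 (fcos f (IZR k))) (pow2_ge_0 (fsin f (IZR k))).
intros; apply Rmult_le_pos; lra.
Qed.

Lemma ex_seriesZ_le (a b : Z -> R) : (forall k, 0 <= a k <= b k) -> ex_seriesZ b -> ex_seriesZ a.
Proof.
intros H [H1 H2]; split.
- apply (ex_series_le (K := R_AbsRing) (V := R_CompleteNormedModule) _ (fun n => b (Z.of_nat n))); auto.
  intros n. change (Rabs (a (Z.of_nat n)) <= b (Z.of_nat n)). rewrite Rabs_pos_eq; apply H.
- apply (ex_series_le (K := R_AbsRing) (V := R_CompleteNormedModule) _ (fun n => b (- Z.of_nat (S n))%Z)); auto.
  intros n. change (Rabs (a (- Z.of_nat (S n))%Z) <= b (- Z.of_nat (S n))%Z). rewrite Rabs_pos_eq; apply H.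
Qed.

Lemma ex_seriesZ_lin (a b : Z -> R) (c d : R) : ex_seriesZ a -> ex_seriesZ b ->
  ex_seriesZ (fun k => c * a k + d * b k).
Proof.
intros [A1 A2] [B1 B2]; split;
  apply (ex_series_plus (K := R_AbsRing) (V := R_NormedModule));
  apply (ex_series_scal (K := R_AbsRing) (V := R_NormedModule)); assumption.
Qed.

Lemma ex_series_finite (a : nat -> R) (N : nat) : (forall n, (N <= n)%nat -> a n = 0) -> ex_series a.
Proof.
intros H. apply (ex_series_incr_n a N).
(* The tail is identically zero; it is presented as 0 times a series known to converge. *)
apply (ex_series_ext (fun n => scal 0 (helm (S n)))).
- intros n. rewrite H by lia. unfold scal; simpl; unfold mult; simpl; ring.
- apply (ex_series_scal (K := R_AbsRing) (V := R_NormedModule)). apply ex_series_helm_S.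
Qed.

Lemma ex_seriesZ_finite (a : Z -> R) : (forall k, k <> 0%Z -> k <> 1%Z -> k <> (-1)%Z -> a k = 0) -> ex_seriesZ a.
Proof.
intros H; split; apply (ex_series_finite _ 2); intros n Hn; apply H; lia.
Qed.

Lemma ex_seriesZ_ext (a b : Z -> R) : (forall k, a k = b k) -> ex_seriesZ a -> ex_seriesZ b.
Proof.
intros H Ha. replace b with a; [exact Ha|]. now apply functional_extensionality.
Qed.

(** Mode by mode, (a - b)^2 <= 2 a^2 + 2 b^2, the gap being (a + b)^2. *)
Lemma in_H1_minus (f g : R -> R) : in_H1 f -> in_H1 g -> in_H1 (fun x => f x - g x).
Proof.
intros [Pf [Cf Sf]] [Pg [Cg Sg]]. change (cont f) in Cf; change (cont g) in Cg.
split; [|split].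
- intros x; now rewrite Pf, Pg.
- change (cont (fun x => f x - g x)); ct.
- refine (ex_seriesZ_le _ _ _ (ex_seriesZ_lin _ _ 2 2 Sf Sg)).
  intros k; split; [apply H1_weight_nonneg|]. rewrite !H1_weight_eq.
  replace (fcos (fun x => f x - g x) (IZR k)) with (fcos f (IZR k) - fcos g (IZR k)).
  replace (fsin (fun x => f x - g x) (IZR k)) with (fsin f (IZR k) - fsin g (IZR k)).
  + generalize (fcos f (IZR k)) (fcos g (IZR k)) (fsin f (IZR k)) (fsin g (IZR k)) (pow2_ge_0 (IZR k)).
    intros a b c d Hk.
    replace (2 * ((1 + IZR k ^ 2) * (a ^ 2 + c ^ 2)) + 2 * ((1 + IZR k ^ 2) * (b ^ 2 + d ^ 2)))
      with ((1 + IZR k ^ 2) * (2 * (a ^ 2 + c ^ 2) + 2 * (b ^ 2 + d ^ 2))) by ring.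
    apply Rmult_le_compat_l; [lra|]. generalize (pow2_ge_0 (a + b)) (pow2_ge_0 (c + d)); lra.
  + unfold fsin; rewrite <- mean_minus by ct; apply mean_ext; intros; ring.
  + unfold fcos; rewrite <- mean_minus by ct; apply mean_ext; intros; ring.
Qed.

(** Reflection acts on the pair ([fcos], [fsin]) by an orthogonal matrix with entries cos (k c) and
    sin (k c), so the sum of squares is unchanged. *)
Lemma H1_weight_reflect (f : R -> R) (c : R) (k : Z) : cont f -> periodic f ->
  H1_weight (fun x => f (c - x)) k = H1_weight f k.
Proof.
intros Hc Hp. rewrite !H1_weight_eq. f_equal.
assert (E1 : fcos (fun x => f (c - x)) (IZR k) = cos (IZR k * c) * fcos f (IZR k) + sin (IZR k * c) * fsin f (IZR k)).
{ unfold fcos, fsin. rewrite <- !mean_scal, <- mean_plus by ct.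
  rewrite <- (mean_reflect (fun x => cos (IZR k * c) * (f x * cos (IZR k * x)) + _) c).
  - apply mean_ext; intros x.
    replace (cos (IZR k * x)) with (cos (IZR k * c - IZR k * (c - x))) by (f_equal; ring).
    rewrite cos_minus; ring.
  - ct.
  - intros x. now rewrite Hp, (cos_period_Z k x), (sin_period_Z k x). }
assert (E2 : fsin (fun x => f (c - x)) (IZR k) = sin (IZR k * c) * fcos f (IZR k) - cos (IZR k * c) * fsin f (IZR k)).
{ unfold fcos, fsin. rewrite <- !mean_scal, <- mean_minus by ct.
  rewrite <- (mean_reflect (fun x => sin (IZR k * c) * (f x * cos (IZR k * x)) - _) c).
  - apply mean_ext; intros x.
    replace (sin (IZR k * x)) with (sin (IZR k * c - IZR k * (c - x))) by (f_equal; ring).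
    rewrite sin_minus; ring.
  - ct.
  - intros x. now rewrite Hp, (cos_period_Z k x), (sin_period_Z k x). }
rewrite E1, E2.
generalize (sin2_cos2 (IZR k * c)); unfold Rsqr; intros E.
transitivity ((sin (IZR k * c) * sin (IZR k * c) + cos (IZR k * c) * cos (IZR k * c))
  * (fcos f (IZR k) ^ 2 + fsin f (IZR k) ^ 2)); [ring|]. rewrite E; ring.
Qed.

Lemma in_H1_reflect (f : R -> R) (c : R) : in_H1 f -> in_H1 (fun x => f (c - x)).
Proof.
intros [Hp [Hc Hs]]. change (cont f) in Hc. split; [|split].
- intros x. rewrite <- Hp. f_equal; ring.
- change (cont (fun x => f (c - x))); ct.
- revert Hs; apply ex_seriesZ_ext. intros k; symmetry; now apply H1_weight_reflect.
Qed.

(** Only the modes 0, 1 and -1 occur. The coefficients a and b cover the example in (ii) as well as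
    the constants, which enter through the -2 of the reflection. *)
Lemma in_H1_sin (a b x0 : R) : in_H1 (fun x => a + b * sin (x - x0)).
Proof.
assert (Hs : forall k, mean (fun x => sin (x - x0) * cos (IZR k * x)) =
    cos x0 * mean (fun x => sin (IZR 1 * x) * cos (IZR k * x))
    - sin x0 * mean (fun x => cos (IZR 1 * x) * cos (IZR k * x))).
{ intros k. rewrite <- !mean_scal, <- mean_minus by ct. apply mean_ext; intros x.
  rewrite sin_minus, !Rmult_1_l; ring. }
assert (Hs' : forall k, mean (fun x => sin (x - x0) * sin (IZR k * x)) =
    cos x0 * mean (fun x => sin (IZR 1 * x) * sin (IZR k * x))
    - sin x0 * mean (fun x => sin (IZR k * x) * cos (IZR 1 * x))).
{ intros k. rewrite <- !mean_scal, <- mean_minus by ct. apply mean_ext; intros x.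
  rewrite sin_minus, !Rmult_1_l; ring. }
split; [|split].
- intros x. replace (x + 2 * PI - x0) with (x - x0 + 2 * PI) by ring.
  now rewrite (sin_plus (x - x0)), cos_2PI, sin_2PI, Rmult_0_r, Rmult_1_r, Rplus_0_r.
- change (cont (fun x => a + b * sin (x - x0))); ct.
- apply ex_seriesZ_finite. intros k H0 H1 H2. rewrite H1_weight_eq.
  replace (fcos _ (IZR k)) with 0; [replace (fsin _ (IZR k)) with 0; [ring|]|].
  + unfold fsin. rewrite (mean_ext _ (fun x => a * sin (IZR k * x) + b * (sin (x - x0) * sin (IZR k * x)))) by (intros; ring).
    rewrite mean_plus, !mean_scal, mean_sin_Z, Hs', mean_sin_sin, mean_sin_cos, !mean_cos_Z by (ct || lia). ring.
  + unfold fcos. rewrite (mean_ext _ (fun x => a * cos (IZR k * x) + b * (sin (x - x0) * cos (IZR k * x)))) by (intros; ring).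
    rewrite mean_plus, !mean_scal, Hs, mean_cos_cos, mean_sin_cos, !mean_cos_Z by (ct || lia). ring.
Qed.

Lemma in_H1_const (a : R) : in_H1 (fun _ => a).
Proof.
replace (fun _ : R => a) with (fun x => a + 0 * sin (x - 0)); [apply in_H1_sin|].
apply functional_extensionality; intros; ring.
Qed.

Lemma Series_ge_partial (a : nat -> R) (N : nat) : (forall n, 0 <= a n) -> ex_series a -> sum_n a N <= Series a.
Proof.
intros Hp Hs. apply (is_lim_seq_incr_compare (sum_n a)).
- exact (Series_correct _ Hs).
- intros n; rewrite sum_Sn; unfold plus; simpl. generalize (Hp (S n)); lra.
Qed.

(** The modes k < 0 contribute nonnegatively to the norm and are dropped. *)
Lemma H1_partial_le (f : R -> R) (N : nat) : in_H1 f ->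
  H1_weight f 0 + sum1 (fun n => H1_weight f (Z.of_nat n)) N <= H1_norm f ^ 2.
Proof.
intros [Hp [Hc [S1 S2]]].
assert (P2 : 0 <= Series (fun n => H1_weight f (- Z.of_nat (S n)))).
{ eapply Rle_trans; [|apply (Series_ge_partial _ 0); [intros; apply H1_weight_nonneg|exact S2]].
  rewrite sum_O. apply H1_weight_nonneg. }
assert (P1 : H1_weight f 0 + sum1 (fun n => H1_weight f (Z.of_nat n)) N
   <= Series (fun n => H1_weight f (Z.of_nat n))).
{ replace (H1_weight f 0 + sum1 (fun n => H1_weight f (Z.of_nat n)) N)
    with (sum_n (fun n => H1_weight f (Z.of_nat n)) N).
  - apply Series_ge_partial; [intros; apply H1_weight_nonneg|exact S1].
  - induction N as [|N IH]; [rewrite sum_O; simpl; ring|].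
    rewrite sum_Sn, IH. cbn [sum1]. unfold plus; simpl; ring. }
unfold H1_norm. rewrite pow2_sqrt; unfold SeriesZ; [lra|].
assert (0 <= Series (fun n => H1_weight f (Z.of_nat n))); [|lra].
eapply Rle_trans; [|apply (Series_ge_partial _ 0); [intros; apply H1_weight_nonneg|exact S1]].
rewrite sum_O. apply H1_weight_nonneg.
Qed.

Lemma psum_abs_le (f : R -> R) (N : nat) (x : R) :
  Rabs (psum (fun _ => 1) f N x) <=
  Rabs (mean f) + 2 * sum1 (fun n => Rabs (fcos f (INR n)) + Rabs (fsin f (INR n))) N.
Proof.
induction N as [|N IH]; cbn [psum sum1]; [rewrite Rmult_1_l; lra|].
eapply Rle_trans; [apply Rabs_triang|]. set (w := INR (S N)).
assert (Rabs (2 * 1 * (fcos f w * cos (w * x) + fsin f w * sin (w * x))) <= 2 * (Rabs (fcos f w) + Rabs (fsin f w))).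
{ rewrite Rmult_1_r, Rabs_mult, (Rabs_pos_eq 2) by lra. apply Rmult_le_compat_l; [lra|].
  eapply Rle_trans; [apply Rabs_triang|]. rewrite !Rabs_mult.
  assert (Rabs (cos (w * x)) <= 1) by apply Rabs_le, COS_bound.
  assert (Rabs (sin (w * x)) <= 1) by apply Rabs_le, SIN_bound.
  generalize (Rabs_pos (fcos f w)) (Rabs_pos (fsin f w)); intros. nra. }
lra.
Qed.

(** AM-GM for e h and a^2/(e h). With h = [helm n] the first part is summable and the second is a
    term of the H^1 norm, so this replaces Cauchy-Schwarz for the sums. *)
Lemma abs_amgm (a e h : R) : 0 < e -> 0 < h -> Rabs a <= / 2 * e * h + / (2 * e) * (/ h * a ^ 2).
Proof.
intros He Hh. rewrite <- (pow2_abs a). set (b := Rabs a). clearbody b.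
assert (0 <= (e * h - b) ^ 2) by apply pow2_ge_0.
apply (Rmult_le_reg_r (2 * e * h)); [apply Rmult_lt_0_compat; lra|].
replace ((/ 2 * e * h + / (2 * e) * (/ h * b ^ 2)) * (2 * e * h)) with (e * h * (e * h) + b ^ 2) by (field; lra).
lra.
Qed.

(** The mean contributes e and the other modes 2 (2 e + e/2). The bound is stated with a positive
    [e] above the norm because the AM-GM step divides by [e], while the norm may vanish. *)
Lemma sobolev (f : R -> R) (e x : R) : in_H1 f -> 0 < e -> H1_norm f <= e -> Rabs (f x) <= 6 * e.
Proof.
intros Hf He Hn. assert (Hf0 := Hf). destruct Hf0 as [Hp [Hc _]]. change (cont f) in Hc.
assert (Hn2 : H1_norm f ^ 2 <= e ^ 2) by (apply pow_incr; split; [apply sqrt_pos|exact Hn]).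
apply fejer_bound; auto. intros N.
generalize (H1_partial_le f N Hf); intros HP.
assert (Hm : Rabs (mean f) <= e).
{ generalize (H1_partial_le f 0 Hf). cbn [sum1]. rewrite H1_weight_eq, fcos_0, fsin_0. intros Hm.
  rewrite <- (sqrt_pow2 e), <- sqrt_Rsqr_abs by lra. apply sqrt_le_1_alt. unfold Rsqr. nra. }
eapply Rle_trans; [apply psum_abs_le|].
assert (Hs : sum1 (fun n => Rabs (fcos f (INR n)) + Rabs (fsin f (INR n))) N
   <= e * sum1 helm N + / (2 * e) * sum1 (fun n => H1_weight f (Z.of_nat n)) N).
{ rewrite <- !sum1_scal, <- sum1_plus. apply sum1_le. intros n Hn1.
  rewrite H1_weight_eq, <- INR_IZR_INZ.
  generalize (abs_amgm (fcos f (INR n)) e (helm n) He (helm_pos n))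
    (abs_amgm (fsin f (INR n)) e (helm n) He (helm_pos n)).
  replace (/ helm n) with (1 + INR n ^ 2) by (unfold helm; now rewrite Rinv_inv). lra. }
generalize (sum1_helm_le N) (H1_weight_nonneg f 0); intros Hh H0.
assert (/ (2 * e) * sum1 (fun n => H1_weight f (Z.of_nat n)) N <= e / 2).
{ apply Rle_trans with (/ (2 * e) * e ^ 2); [|right; field; lra].
  apply Rmult_le_compat_l; [left; apply Rinv_0_lt_compat; lra|lra]. }
nra.
Qed.

(** * Joint continuity and smooth cutoffs *)

Lemma archimed_nat (x : R) : exists n : nat, x <= INR n.
Proof.
destruct (archimed x) as [H _]. exists (Z.to_nat (up x)).
rewrite INR_IZR_INZ. apply Rle_trans with (IZR (up x)); [lra|]. apply IZR_le; lia.
Qed.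

Definition cont2 (g : R -> R -> R) : Prop := forall x t, continuity_2d_pt g x t.

Lemma cont2_fst (f : R -> R) : cont f -> cont2 (fun x _ => f x).
Proof.
intros H x t e. destruct (cont_eps f x e H (cond_pos e)) as [d [Hd Hf]].
exists (mkposreal d Hd); intros u v Hu _; exact (Hf u Hu).
Qed.

Lemma cont2_snd (f : R -> R) : cont f -> cont2 (fun _ t => f t).
Proof.
intros H x t e. destruct (cont_eps f t e H (cond_pos e)) as [d [Hd Hf]].
exists (mkposreal d Hd); intros u v _ Hv; exact (Hf v Hv).
Qed.

Lemma cont2_plus (f g : R -> R -> R) : cont2 f -> cont2 g -> cont2 (fun x t => f x t + g x t).
Proof. intros Hf Hg x t; now apply continuity_2d_pt_plus. Qed.

Lemma cont2_minus (f g : R -> R -> R) : cont2 f -> cont2 g -> cont2 (fun x t => f x t - g x t).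
Proof. intros Hf Hg x t; now apply continuity_2d_pt_minus. Qed.

Lemma cont2_mult (f g : R -> R -> R) : cont2 f -> cont2 g -> cont2 (fun x t => f x t * g x t).
Proof. intros Hf Hg x t; now apply continuity_2d_pt_mult. Qed.

Lemma cont2_pow (f : R -> R -> R) (n : nat) : cont2 f -> cont2 (fun x t => f x t ^ n).
Proof.
intros Hf; induction n as [|n IH]; simpl.
- apply (cont2_fst (fun _ => 1)), cont_const.
- now apply cont2_mult.
Qed.

Lemma cont2_const (c : R) : cont2 (fun _ _ => c).
Proof. apply (cont2_fst (fun _ => c)), cont_const. Qed.

Lemma cont2_x (g : R -> R -> R) (t : R) : cont2 g -> cont (fun x => g x t).
Proof.
intros H; apply eps_cont; intros x e He. destruct (H x t (mkposreal e He)) as [d Hd].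
exists d; split; [apply cond_pos|]. intros y Hy; apply Hd; [exact Hy|].
unfold Rminus; rewrite Rplus_opp_r, Rabs_R0; apply cond_pos.
Qed.

Lemma cont2_reflect (g : R -> R -> R) (c : R) : cont2 g -> cont2 (fun x t => g (c - x) t).
Proof.
intros H x t e. destruct (H (c - x) t e) as [d Hd].
exists d; intros u v Hu Hv; apply Hd; [|exact Hv].
replace (c - u - (c - x)) with (- (u - x)) by ring. now rewrite Rabs_Ropp.
Qed.

Ltac ct2 :=
  unfold Rdiv;
  repeat match goal with
  | H : cont2 ?f |- cont2 ?f => exact H
  | H : cont2 ?f |- cont2 (fun x t => ?f x t) => exact H
  | H : cont2 ?f |- cont2 (fun x t => ?f (?c - x) t) => apply (cont2_reflect f c)
  | |- cont2 (fun _ _ => ?c) => apply (cont2_const c)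
  | |- cont2 (fun x t => @?f x) => apply (cont2_fst f); ct
  | |- cont2 (fun x t => @?f t) => apply (cont2_snd f); ct
  | |- cont2 (fun x t => @?f x t + @?g x t) => apply (cont2_plus f g)
  | |- cont2 (fun x t => @?f x t - @?g x t) => apply (cont2_minus f g)
  | |- cont2 (fun x t => @?f x t * @?g x t) => apply (cont2_mult f g)
  | |- cont2 (fun x t => @?f x t ^ ?n) => apply (cont2_pow f n)
  end.

Lemma cont_RInt_param (g : R -> R -> R) (a b : R) : a <= b -> cont2 g -> cont (fun t => RInt (fun x => g x t) a b).
Proof.
intros Hab H; apply eps_cont; intros t e He.
assert (He' : 0 < e / (b - a + 1)) by (apply Rdiv_lt_0_compat; lra).
destruct (uniform_continuity_2d_1d g a b t (fun x _ => H x t) (mkposreal _ He')) as [d Hd].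
exists d; split; [apply cond_pos|]. intros s Hs.
rewrite <- RInt_sub by now apply cont2_x.
apply Rle_lt_trans with ((b - a) * (e / (b - a + 1))).
- apply abs_RInt_le_const; [exact Hab| |].
  + apply cont_ex_RInt, cont_minus; now apply cont2_x.
  + intros x Hx. left. apply Rabs_def2 in Hs. apply (Hd x t x s); try (generalize (cond_pos d); intros; split; lra).
    unfold Rminus at 1; rewrite Rplus_opp_r, Rabs_R0; apply cond_pos.
- apply Rlt_le_trans with ((b - a + 1) * (e / (b - a + 1))); [|right; field; lra].
  apply Rmult_lt_compat_r; lra.
Qed.

Lemma cont_mean_param (g : R -> R -> R) : cont2 g -> cont (fun t => mean (fun x => g x t)).
Proof.
intros H; unfold mean. apply cont_mult; [ct|].
apply cont_RInt_param; [left; apply two_PI_pos|exact H].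
Qed.

(** Every point of the rectangle is joined to the corner (a, c) by finitely many steps of length at
    most e/2 in each coordinate, and uniform continuity bounds the change of [g] per step by 1. *)
Lemma cont2_bounded (g : R -> R -> R) (a b c d : R) : cont2 g ->
  exists M, forall x t, a <= x <= b -> c <= t <= d -> Rabs (g x t) <= M.
Proof.
intros H.
destruct (uniform_continuity_2d g a b c d (fun x t _ _ => H x t) (mkposreal 1 Rlt_0_1)) as [e He].
assert (He0 := cond_pos e). simpl in He.
assert (Hn : forall n x t, a <= x <= b -> c <= t <= d ->
  x - a <= INR n * (e / 2) -> t - c <= INR n * (e / 2) -> Rabs (g x t) <= Rabs (g a c) + INR n).
{ induction n as [|n IH]; intros x t Hx Ht Hx' Ht'.
  - simpl in *. replace x with a by lra. replace t with c by lra. lra.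
  - rewrite S_INR in *.
    assert (Hx1 := Rmax_l a (x - e / 2)). assert (Hx2 := Rmax_r a (x - e / 2)).
    assert (Ht1 := Rmax_l c (t - e / 2)). assert (Ht2 := Rmax_r c (t - e / 2)).
    assert (Hx3 : Rmax a (x - e / 2) <= x) by (apply Rmax_lub; lra).
    assert (Ht3 : Rmax c (t - e / 2) <= t) by (apply Rmax_lub; lra).
    assert (Hn0 := pos_INR n).
    assert (Rmax a (x - e / 2) - a <= INR n * (e / 2)) by (apply Rmax_case; nra).
    assert (Rmax c (t - e / 2) - c <= INR n * (e / 2)) by (apply Rmax_case; nra).
    set (x' := Rmax a (x - e / 2)) in *. set (t' := Rmax c (t - e / 2)) in *.
    assert (IH' : Rabs (g x' t') <= Rabs (g a c) + INR n) by (apply IH; lra).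
    assert (Rabs (g x t - g x' t') < 1).
    { apply He; try lra; rewrite Rabs_pos_eq; lra. }
    generalize (Rabs_triang_inv (g x t) (g x' t')). lra. }
destruct (archimed_nat ((Rabs (b - a) + Rabs (d - c)) / (e / 2))) as [n Hn1].
exists (Rabs (g a c) + INR n). intros x t Hx Ht.
assert (Rabs (b - a) + Rabs (d - c) <= INR n * (e / 2)).
{ apply (Rmult_le_compat_r (e / 2)) in Hn1; [|lra].
  replace ((Rabs (b - a) + Rabs (d - c)) / (e / 2) * (e / 2)) with (Rabs (b - a) + Rabs (d - c)) in Hn1 by (field; lra).
  exact Hn1. }
generalize (Rle_abs (b - a)) (Rle_abs (d - c)) (Rabs_pos (b - a)) (Rabs_pos (d - c)); intros.
apply Hn; lra.
Qed.

Lemma C_H1_uniform (u : R -> R -> R) (t e : R) : C_H1 u -> 0 < e ->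
  exists d, 0 < d /\ forall s x, Rabs (s - t) < d -> Rabs (u x s - u x t) < e.
Proof.
intros [HH HC] He.
(* Any divisor above the Sobolev constant 6 keeps the final inequality strict. *)
assert (He' : 0 < e / 7) by lra.
destruct (proj1 (filterlim_locally _ 0) (HC t) (mkposreal _ He')) as [d Hd].
exists d; split; [apply cond_pos|]. intros s x Hs.
specialize (Hd s Hs). change (Rabs (H1_norm (fun x => u x s - u x t) - 0) < e / 7) in Hd.
rewrite Rminus_0_r in Hd. apply Rle_lt_trans with (6 * (e / 7)); [|lra].
apply (sobolev (fun x => u x s - u x t)); [apply in_H1_minus; apply HH|lra|].
left. eapply Rle_lt_trans; [apply Rle_abs|exact Hd].
Qed.

(** Continuity in time is uniform in x, so continuity in x at the single time [t] suffices for joint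
    continuity. *)
Lemma C_H1_cont2 (u : R -> R -> R) : C_H1 u -> cont2 u.
Proof.
intros H x t e.
destruct (C_H1_uniform u t (e / 2) H) as [d1 [Hd1 H1]]; [generalize (cond_pos e); lra|].
destruct (cont_eps (fun y => u y t) x (e / 2)) as [d2 [Hd2 H2]];
  [exact (proj1 (proj2 (proj1 H t)))|generalize (cond_pos e); lra|].
assert (Hd : 0 < Rmin d1 d2) by now apply Rmin_glb_lt.
exists (mkposreal _ Hd); simpl. intros y s Hy Hs.
assert (Hy' : Rabs (y - x) < d2) by (eapply Rlt_le_trans; [exact Hy|apply Rmin_r]).
assert (Hs' : Rabs (s - t) < d1) by (eapply Rlt_le_trans; [exact Hs|apply Rmin_l]).
specialize (H1 s y Hs'). specialize (H2 y Hy').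
replace (u y s - u x t) with (u y s - u y t + (u y t - u x t)) by ring.
eapply Rle_lt_trans; [apply Rabs_triang|]. lra.
Qed.

Lemma C_H1_bounded (u : R -> R -> R) (a b : R) : C_H1 u ->
  exists M, forall x t, a <= t <= b -> Rabs (u x t) <= M.
Proof.
intros H. destruct (cont2_bounded u 0 (2 * PI) a b (C_H1_cont2 u H)) as [M HM].
exists M; intros x t Ht. destruct (periodic_reduce x) as [k Hk].
rewrite <- (periodic_Z (fun x => u x t) k x (proj1 (proj1 H t))). now apply HM.
Qed.

(** One derivative is peeled off per level, as in [ex_diff_n], so that smoothness of product test
    functions follows by the same recursion. *)
Fixpoint CkR (n : nat) (f : R -> R) : Prop :=
  match n with
  | O => cont f
  | S m => (forall x, ex_derive f x) /\ CkR m (Derive f)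
  end.

Lemma CkR_cont (n : nat) (f : R -> R) : CkR n f -> cont f.
Proof. destruct n; simpl; [auto|]. intros [H _]; now apply cont_derivable. Qed.

Lemma CkR_pred (n : nat) (f : R -> R) : CkR (S n) f -> CkR n f.
Proof.
revert f; induction n as [|n IH]; intros f.
- intros [H _]; now apply cont_derivable.
- intros [H1 H2]; split; [exact H1|]. now apply IH.
Qed.

Lemma CkR_S (n : nat) (f f' : R -> R) : (forall x, is_derive f x (f' x)) -> CkR n f' -> CkR (S n) f.
Proof.
intros H H'; split; [intros x; exists (f' x); apply H|].
replace (Derive f) with f'; [exact H'|]. apply functional_extensionality; intros x.
symmetry; apply is_derive_unique, H.
Qed.

Lemma CkR_const (n : nat) (c : R) : CkR n (fun _ => c).
Proof.
revert c; induction n as [|n IH]; intros c; [apply cont_const|].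
apply (CkR_S n _ (fun _ => 0)); [|apply IH]. intros x; apply (is_derive_const (V := R_NormedModule)).
Qed.

Lemma CkR_plus (n : nat) (f g : R -> R) : CkR n f -> CkR n g -> CkR n (fun x => f x + g x).
Proof.
revert f g; induction n as [|n IH]; intros f g; [apply cont_plus|].
intros [F1 F2] [G1 G2]. apply (CkR_S n _ (fun x => Derive f x + Derive g x)); [|now apply IH].
intros x; apply (is_derive_plus f g); now apply Derive_correct.
Qed.

Lemma CkR_mult (n : nat) (f g : R -> R) : CkR n f -> CkR n g -> CkR n (fun x => f x * g x).
Proof.
revert f g; induction n as [|n IH]; intros f g; [apply cont_mult|].
intros F G. assert (F' := CkR_pred n f F). assert (G' := CkR_pred n g G).
destruct F as [F1 F2]; destruct G as [G1 G2].
apply (CkR_S n _ (fun x => Derive f x * g x + f x * Derive g x)).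
- intros x; apply (is_derive_mult f g x); [now apply Derive_correct|now apply Derive_correct|].
  intros; apply Rmult_comm.
- apply CkR_plus; now apply IH.
Qed.

Lemma CkR_affine (n : nat) (f : R -> R) (a b : R) : CkR n f -> CkR n (fun x => f (a * x + b)).
Proof.
revert f; induction n as [|n IH]; intros f.
- intros H; simpl in *. ct.
- intros [H1 H2]. apply (CkR_S n _ (fun x => a * Derive f (a * x + b))).
  + intros x. apply (is_derive_comp f (fun x => a * x + b) x (Derive f (a * x + b)) a).
    * now apply Derive_correct.
    * auto_derive; [exact I|ring].
  + apply CkR_mult; [apply CkR_const|now apply IH].
Qed.

Lemma CkR_trig (n : nat) (w : R) : CkR n (fun x => cos (w * x)) /\ CkR n (fun x => sin (w * x)).
Proof.
induction n as [|n [IH1 IH2]]; [split; simpl; ct|]. split.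
- apply (CkR_S n _ (fun x => - w * sin (w * x))); [intros x; auto_derive; [exact I|ring]|].
  apply (CkR_mult n (fun _ => - w)); [apply CkR_const|exact IH2].
- apply (CkR_S n _ (fun x => w * cos (w * x))); [intros x; auto_derive; [exact I|ring]|].
  apply (CkR_mult n (fun _ => w)); [apply CkR_const|exact IH1].
Qed.

(** The classical exp (-1/x) with extra negative powers: the derivative of [flat n] is a combination
    of [flat (n+1)] and [flat (n+2)], so the family is closed and smoothness is an induction. *)
Definition flat (n : nat) (x : R) : R := if Rlt_dec 0 x then (/ x) ^ n * exp (- / x) else 0.

Lemma flat_pos (n : nat) (x : R) : 0 < x -> flat n x = (/ x) ^ n * exp (- / x).
Proof. intros H; unfold flat; destruct (Rlt_dec 0 x); [reflexivity|lra]. Qed.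

Lemma flat_neg (n : nat) (x : R) : x <= 0 -> flat n x = 0.
Proof. intros H; unfold flat; destruct (Rlt_dec 0 x); [lra|reflexivity]. Qed.

(** The Taylor term of order n + 2 bounds exp (1/x) from below. The two spare powers give quadratic
    decay, hence derivative 0 at the origin. *)
Lemma flat_bound (n : nat) (x : R) : Rabs (flat n x) <= INR (fact (n + 2)) * x ^ 2.
Proof.
assert (Hf : 0 < INR (fact (n + 2))) by (apply lt_0_INR, lt_O_fact).
destruct (Rle_lt_dec x 0) as [Hx|Hx].
- rewrite flat_neg, Rabs_R0 by exact Hx. apply Rmult_le_pos; [lra|apply pow2_ge_0].
- rewrite flat_pos by exact Hx. assert (Hy : 0 < / x) by now apply Rinv_0_lt_compat.
  assert (Hyn : 0 < (/ x) ^ n) by now apply pow_lt.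
  rewrite Rabs_pos_eq by (apply Rmult_le_pos; [lra|left; apply exp_pos]).
  assert (He : (/ x) ^ (n + 2) / INR (fact (n + 2)) <= exp (/ x)).
  { eapply Rle_trans; [|apply (exp_ge_taylor (/ x) (n + 2)); lra].
    replace (n + 2)%nat with (S (n + 1)) by lia. rewrite tech5.
    assert (0 <= sum_f_R0 (fun k => (/ x) ^ k / INR (fact k)) (n + 1)); [|lra].
    apply cond_pos_sum; intros k. apply Rmult_le_pos; [apply pow_le; lra|].
    left; apply Rinv_0_lt_compat, lt_0_INR, lt_O_fact. }
  rewrite exp_Ropp.
  apply (Rmult_le_reg_r (exp (/ x))); [apply exp_pos|].
  rewrite Rmult_assoc, Rinv_l, Rmult_1_r by (apply Rgt_not_eq, exp_pos).
  apply Rle_trans with (INR (fact (n + 2)) * x ^ 2 * ((/ x) ^ (n + 2) / INR (fact (n + 2)))).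
  + rewrite pow_add. right; field. split; [lra|]. apply not_0_INR, fact_neq_0.
  + apply Rmult_le_compat_l; [|exact He]. apply Rmult_le_pos; [lra|apply pow2_ge_0].
Qed.

Lemma flat_derive (n : nat) (x : R) : is_derive (flat n) x (- INR n * flat (S n) x + flat (S (S n)) x).
Proof.
destruct (Rtotal_order x 0) as [Hx|[Hx|Hx]].
- rewrite !flat_neg by lra. replace (- INR n * 0 + 0) with 0 by ring.
  apply (is_derive_ext_loc (fun _ => 0)); [|apply (is_derive_const (V := R_NormedModule))].
  assert (Hd : 0 < - x) by lra. exists (mkposreal _ Hd). intros y Hy.
  change (Rabs (y - x) < - x) in Hy. apply Rabs_def2 in Hy. rewrite flat_neg; lra.
- subst x. rewrite !flat_neg by lra. replace (- INR n * 0 + 0) with 0 by ring.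
  apply is_derive_Reals. intros e He.
  assert (Hf : 0 < INR (fact (n + 2))) by (apply lt_0_INR, lt_O_fact).
  (* By [flat_bound] the difference quotient at 0 is at most (n + 2)! |h|, hence this radius. *)
  assert (Hd : 0 < e / INR (fact (n + 2))) by now apply Rdiv_lt_0_compat.
  exists (mkposreal _ Hd). intros h Hh Hhd. simpl in Hhd.
  rewrite (flat_neg n 0) by lra. rewrite Rplus_0_l, !Rminus_0_r.
  unfold Rdiv; rewrite Rabs_mult, Rabs_inv.
  assert (Hh0 : 0 < Rabs h) by now apply Rabs_pos_lt.
  apply (Rmult_lt_reg_r (Rabs h)); [exact Hh0|].
  rewrite Rmult_assoc, Rinv_l, Rmult_1_r by lra.
  eapply Rle_lt_trans; [apply flat_bound|].
  rewrite <- pow2_abs. simpl; rewrite Rmult_1_r, <- Rmult_assoc.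
  apply Rmult_lt_compat_r; [exact Hh0|].
  apply (Rmult_lt_compat_l (INR (fact (n + 2)))) in Hhd; [|exact Hf].
  replace (INR (fact (n + 2)) * (e / INR (fact (n + 2)))) with e in Hhd by (field; lra).
  exact Hhd.
- rewrite !flat_pos by exact Hx.
  apply (is_derive_ext_loc (fun y => (/ y) ^ n * exp (- / y))).
  + exists (mkposreal _ Hx). intros y Hy. change (Rabs (y - x) < x) in Hy.
    apply Rabs_def2 in Hy. rewrite flat_pos; lra.
  + auto_derive; [repeat split; lra|]. destruct n as [|n].
    * simpl. field; lra.
    * rewrite S_INR. simpl pred. simpl. field; lra.
Qed.

Lemma flat_CkR (k n : nat) : CkR k (flat n).
Proof.
revert n; induction k as [|k IH]; intros n.
- intros x. apply (ex_derive_continuous (flat n)). eexists; apply flat_derive.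
- apply (CkR_S k _ (fun x => - INR n * flat (S n) x + flat (S (S n)) x)); [apply flat_derive|].
  apply CkR_plus; [|apply IH]. apply (CkR_mult k (fun _ => - INR n)); [apply CkR_const|apply IH].
Qed.

(** * Weak time derivatives and Fourier modes *)

Lemma ex_diff_n_tensor (n : nat) (z c : R -> R) (x t : R) : CkR n z -> CkR n c ->
  ex_diff_n (fun x t => z x * c t) n x t.
Proof.
revert z c; induction n as [|n IH]; intros z c Hz Hc.
- split; [|exact I]. apply (cont2_mult (fun x _ => z x) (fun _ t => c t)); [now apply cont2_fst|now apply cont2_snd].
- assert (Hz' := CkR_pred n z Hz). assert (Hc' := CkR_pred n c Hc).
  assert (Hz0 := CkR_cont _ _ Hz). assert (Hc0 := CkR_cont _ _ Hc).
  destruct Hz as [Hz1 Hz2]; destruct Hc as [Hc1 Hc2].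
  split; [|split; [|split; [|split]]].
  + apply (cont2_mult (fun x _ => z x) (fun _ t => c t)); [now apply cont2_fst|now apply cont2_snd].
  + apply (ex_derive_mult z (fun _ => c t)); [apply Hz1|apply ex_derive_const].
  + apply (ex_derive_mult (fun _ => z x) c); [apply ex_derive_const|apply Hc1].
  + replace (fun u v => Derive (fun y => z y * c v) u) with (fun u v => Derive z u * c v); [now apply IH|].
    apply functional_extensionality; intros u; apply functional_extensionality; intros v.
    symmetry; apply Derive_scal_l.
  + replace (fun u v => Derive (fun y => z u * c y) v) with (fun u v => z u * Derive c v); [now apply IH|].
    apply functional_extensionality; intros u; apply functional_extensionality; intros v.
    symmetry; apply Derive_scal.
Qed.

Definition cutoff (M : R) (c : R -> R) : Prop :=
  (forall n, CkR n c) /\ forall t, M <= Rabs t -> c t = 0.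

(** Positive exactly on (s - e, s + e). The arguments are written as a * t + b to match
    [CkR_affine]. *)
Definition bump (s e t : R) : R := flat 0 (1 * t + (e - s)) * flat 0 (-1 * t + (s + e)).

Lemma bump_CkR (s e : R) (n : nat) : CkR n (bump s e).
Proof.
apply (CkR_mult n (fun t => flat 0 (1 * t + (e - s))) (fun t => flat 0 (-1 * t + (s + e))));
  apply CkR_affine, flat_CkR.
Qed.

Lemma flat_0_nonneg (x : R) : 0 <= flat 0 x.
Proof.
destruct (Rle_lt_dec x 0) as [H|H]; [rewrite flat_neg; lra|].
rewrite flat_pos by exact H. simpl; rewrite Rmult_1_l; left; apply exp_pos.
Qed.

Lemma flat_0_pos (x : R) : 0 < x -> 0 < flat 0 x.
Proof. intros H; rewrite flat_pos by exact H. simpl; rewrite Rmult_1_l; apply exp_pos. Qed.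

Lemma bump_nonneg (s e t : R) : 0 <= bump s e t.
Proof. apply Rmult_le_pos; apply flat_0_nonneg. Qed.

Lemma bump_zero (s e t : R) : e <= Rabs (t - s) -> bump s e t = 0.
Proof.
intros H; unfold bump. unfold Rabs in H; destruct (Rcase_abs (t - s)).
- rewrite (flat_neg 0 (1 * t + (e - s))) by lra; ring.
- rewrite (flat_neg 0 (-1 * t + (s + e))) by lra; ring.
Qed.

Lemma RInt_zero (f : R -> R) (a b : R) : (forall x, Rmin a b < x < Rmax a b -> f x = 0) -> RInt f a b = 0.
Proof.
intros H. rewrite (RInt_ext f (fun _ => 0)) by exact H. rewrite RInt_cst; apply Rmult_0_r.
Qed.

Definition bump_mass (e : R) : R := RInt (bump 0 e) (- e) e.

Lemma bump_mass_pos (e : R) : 0 < e -> 0 < bump_mass e.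
Proof.
intros He; apply RInt_gt_0; [lra| |intros; apply (CkR_cont 0), bump_CkR].
intros t Ht; apply Rmult_lt_0_compat; apply flat_0_pos; lra.
Qed.

Lemma RInt_bump (s e a b : R) : 0 < e -> a <= s - e -> s + e <= b -> RInt (bump s e) a b = bump_mass e.
Proof.
intros He Ha Hb. assert (Hc : cont (bump s e)) by (apply (CkR_cont 0), bump_CkR).
rewrite <- (RInt_cut _ a (s - e) b Hc), <- (RInt_cut _ (s - e) (s + e) b Hc).
rewrite (RInt_zero _ a), (RInt_zero _ (s + e)).
- unfold bump_mass. replace (s - e) with (- e + s) by ring; replace (s + e) with (e + s) by ring.
  rewrite <- RInt_shift by exact Hc. rewrite Rplus_0_l, Rplus_0_r.
  apply RInt_eq; intros t; unfold bump.
  replace (1 * (t + s) + (e - s)) with (1 * t + (e - 0)) by ring.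
  replace (-1 * (t + s) + (s + e)) with (-1 * t + (0 + e)) by ring. reflexivity.
- intros x Hx. rewrite Rmin_left, Rmax_right in Hx by lra. apply bump_zero.
  rewrite Rabs_pos_eq; lra.
- intros x Hx. rewrite Rmin_left, Rmax_right in Hx by lra. apply bump_zero.
  rewrite Rabs_left; lra.
Qed.

Lemma RInt_mult_bump (c : R -> R) (s d e M : R) : cont c -> 0 < d -> - M <= s - d -> s + d <= M ->
  (forall t, Rabs (t - s) < d -> Rabs (c t - c s) < e) ->
  Rabs (RInt (fun t => c t * bump s d t) (- M) M - c s * bump_mass d) <= e * bump_mass d.
Proof.
intros Hc Hd H1 H2 He. assert (Hb : cont (bump s d)) by (apply (CkR_cont 0), bump_CkR).
rewrite <- (RInt_bump s d (- M) M) by assumption.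
rewrite <- !RInt_mulc, <- RInt_sub by ct.
apply RInt_abs_mono; [lra|ct|ct|]. intros t _.
rewrite <- Rmult_minus_distr_r, Rabs_mult, (Rabs_pos_eq (bump s d t)) by apply bump_nonneg.
destruct (Rlt_le_dec (Rabs (t - s)) d) as [H|H].
- apply Rmult_le_compat_r; [apply bump_nonneg|left; now apply He].
- rewrite bump_zero by exact H. rewrite !Rmult_0_r; lra.
Qed.

(** The test function is the primitive of a bump at [s] minus an equal bump at [r]. Integrating [c]
    against its derivative compares the local averages of [c] at the two points. *)
Lemma du_bois_reymond (c : R -> R) : cont c ->
  (forall M h, 0 < M -> cutoff M h -> RInt (fun t => c t * Derive h t) (- M) M = 0) ->
  forall s r, c s = c r.
Proof.
intros Hc H s r. apply cond_eq. intros e He.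
destruct (cont_eps c s (e / 3) Hc ltac:(lra)) as [d1 [Hd1 H1]].
destruct (cont_eps c r (e / 3) Hc ltac:(lra)) as [d2 [Hd2 H2]].
pose (d := Rmin d1 d2).
assert (Hd : 0 < d) by now apply Rmin_glb_lt.
assert (D1 : d <= d1) by apply Rmin_l. assert (D2 : d <= d2) by apply Rmin_r.
clearbody d.
pose (M := Rabs s + Rabs r + d).
assert (Bs : - M <= s - d /\ s + d <= M).
{ unfold M. generalize (Rle_abs s) (Rle_abs (- s)) (Rabs_pos r). rewrite Rabs_Ropp. lra. }
assert (Br : - M <= r - d /\ r + d <= M).
{ unfold M. generalize (Rle_abs r) (Rle_abs (- r)) (Rabs_pos s). rewrite Rabs_Ropp. lra. }
assert (HM : 0 < M) by lra. clearbody M.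
assert (Cs : cont (bump s d)) by (apply (CkR_cont 0), bump_CkR).
assert (Cr : cont (bump r d)) by (apply (CkR_cont 0), bump_CkR).
pose (eta := fun t => bump s d t + -1 * bump r d t).
assert (Ce : cont eta) by (unfold eta; ct).
assert (Hek : forall n, CkR n eta).
{ intros n. apply CkR_plus; [apply bump_CkR|]. apply (CkR_mult n (fun _ => -1)); [apply CkR_const|apply bump_CkR]. }
assert (Hz : forall t, M <= Rabs t -> eta t = 0).
{ intros t Ht. unfold eta. rewrite !bump_zero; [ring| |];
  unfold Rabs in Ht |- *; destruct (Rcase_abs t); match goal with |- context [Rcase_abs ?x] => destruct (Rcase_abs x) end; lra. }
pose (h := fun t => RInt eta (- M) t).
assert (Hh : forall t, is_derive h t (eta t)) by (intros t; now apply is_derive_primitive).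
assert (Hcut : cutoff M h).
{ split.
  - intros n. apply CkR_pred. apply (CkR_S n h eta Hh). apply Hek.
  - intros t Ht. unfold h. destruct (Rle_lt_dec t 0) as [Ht0|Ht0].
    + rewrite Rabs_left1 in Ht by exact Ht0. apply RInt_zero. intros x Hx.
      rewrite Rmin_right, Rmax_left in Hx by lra. apply Hz. rewrite Rabs_left1; lra.
    + rewrite Rabs_pos_eq in Ht by lra. rewrite <- (RInt_cut eta (- M) M t Ce).
      rewrite (RInt_zero eta M t).
      (* To the right of both bumps the primitive vanishes because their masses are equal; this is
         what makes it compactly supported. *)
      * unfold eta. rewrite RInt_add, RInt_mulc by ct. rewrite !RInt_bump by lra. ring.
      * intros x Hx. rewrite Rmin_left, Rmax_right in Hx by lra. apply Hz. rewrite Rabs_pos_eq; lra. }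
specialize (H M h HM Hcut).
rewrite (RInt_eq _ (fun t => c t * bump s d t - c t * bump r d t)) in H.
2:{ intros t. rewrite (is_derive_unique h t (eta t) (Hh t)). unfold eta; ring. }
rewrite RInt_sub in H by ct.
assert (E1 := RInt_mult_bump c s d (e / 3) M Hc Hd (proj1 Bs) (proj2 Bs) ltac:(intros; apply H1; lra)).
assert (E2 := RInt_mult_bump c r d (e / 3) M Hc Hd (proj1 Br) (proj2 Br) ltac:(intros; apply H2; lra)).
assert (Hm := bump_mass_pos d Hd).
apply (Rmult_lt_reg_r (bump_mass d)); [exact Hm|].
rewrite <- (Rabs_pos_eq (bump_mass d)) at 1 by lra. rewrite <- Rabs_mult, Rmult_minus_distr_r.
apply Rabs_le_between in E1; apply Rabs_le_between in E2.
apply Rle_lt_trans with (e * (2 / 3) * bump_mass d); [apply Rabs_le; lra|].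
apply Rmult_lt_compat_r; lra.
Qed.

Lemma cutoff_cont (M : R) (h : R -> R) : cutoff M h -> cont h /\ cont (Derive h) /\ forall t, is_derive h t (Derive h t).
Proof.
intros [H _]. destruct (H 1%nat) as [H1 H2]. split; [apply (H 0%nat)|split; [exact H2|]].
intros t; apply Derive_correct, H1.
Qed.

(** If B is a primitive of b, then b h + B h' is an exact derivative, so a - B has zero weak
    derivative and is constant. *)
Lemma weak_derivative (a b : R -> R) : cont a -> cont b ->
  (forall M h, 0 < M -> cutoff M h -> RInt (fun t => a t * Derive h t + b t * h t) (- M) M = 0) ->
  forall s t, a t - a s = RInt b s t.
Proof.
intros Ha Hb H s t.
pose (B := fun t => RInt b 0 t).
assert (HB : forall t, is_derive B t (b t)) by (intros r; now apply is_derive_primitive).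
assert (CB : cont B) by (apply cont_derivable; intros r; eexists; apply HB).
assert (E : a t - B t = a s - B s).
{ apply (du_bois_reymond (fun t => a t - B t)); [ct|]. intros M h HM Hh.
  destruct (cutoff_cont M h Hh) as [C1 [C2 D]].
  assert (E1 : RInt (fun t => b t * h t + B t * Derive h t) (- M) M = 0).
  { rewrite (RInt_fundamental (fun t => B t * h t)).
    - rewrite (proj2 Hh M), (proj2 Hh (- M)); [rewrite !Rmult_0_r; apply Rminus_0_r|rewrite Rabs_Ropp|]; apply Rle_abs.
    - intros r. apply (is_derive_mult B h r); [apply HB|apply D|intros; apply Rmult_comm].
    - ct. }
  specialize (H M h HM Hh). rewrite RInt_add in E1, H by ct.
  rewrite (RInt_eq _ (fun t => a t * Derive h t - B t * Derive h t)) by (intros; ring).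
  rewrite RInt_sub by ct. lra. }
unfold B in E. generalize (RInt_cut b 0 s t Hb). lra.
Qed.

(** * From the weak formulation to an integral equation for each Fourier mode *)

Definition flux (u : R -> R -> R) (x t : R) : R := u x t + u x t ^ 2 / 2.

Lemma cont2_flux (u : R -> R -> R) : cont2 u -> cont2 (flux u).
Proof. intros H. change (cont2 (fun x t => u x t + u x t ^ 2 / 2)). ct2. Qed.

(** Test functions of the form z(x) h(t) reduce the equation to a scalar weak derivative in time;
    [z1] and [z2] stand for z' and z''. *)
Lemma bbm_tested (u : R -> R -> R) (z z1 z2 : R -> R) : BBM_solution u ->
  (forall n, CkR n z) -> periodic z ->
  (forall x, is_derive z x (z1 x)) -> (forall x, is_derive z1 x (z2 x)) -> cont z1 -> cont z2 ->
  forall s t, mean (fun x => u x t * (z x - z2 x)) - mean (fun x => u x s * (z x - z2 x)) =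
    RInt (fun r => mean (fun x => flux u x r * z1 x)) s t.
Proof.
intros [HC HD] Hk Hp D1 D2 C1 C2.
assert (C0 : cont z) by apply (Hk 0%nat).
assert (Cu := C_H1_cont2 u HC). assert (Cf := cont2_flux u Cu).
apply (weak_derivative (fun t => mean (fun x => u x t * (z x - z2 x))) (fun r => mean (fun x => flux u x r * z1 x))).
- apply (cont_mean_param (fun x t => u x t * (z x - z2 x))). ct2.
- apply (cont_mean_param (fun x t => flux u x t * z1 x)). ct2.
- intros M h HM Hh. destruct (cutoff_cont M h Hh) as [Ch [Ch' Dh]].
  assert (Ht : test_function M (fun x t => z x * h t)).
  { split; [|split].
    - intros t x; now rewrite Hp.
    - intros n x t; apply ex_diff_n_tensor; [apply Hk|apply Hh].
    - intros x t Ht. rewrite (proj2 Hh t Ht); ring. }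
  specialize (HD M _ HM Ht).
  assert (P01 : forall x t, partial_derive 0 1 (fun x t => z x * h t) x t = z x * Derive h t).
  { intros x t; unfold partial_derive; simpl. apply Derive_scal. }
  assert (P21 : forall x t, partial_derive 2 1 (fun x t => z x * h t) x t = z2 x * Derive h t).
  { intros x t; unfold partial_derive; simpl.
    rewrite (Derive_ext _ (fun x => z1 x * Derive h t)).
    - rewrite Derive_scal_l. now rewrite (is_derive_unique z1 x _ (D2 x)).
    - intros y. rewrite (Derive_ext _ (fun x => z x * Derive h t)) by (intros; apply Derive_scal).
      rewrite Derive_scal_l. now rewrite (is_derive_unique z y _ (D1 y)). }
  assert (P10 : forall x t, partial_derive 1 0 (fun x t => z x * h t) x t = z1 x * h t).
  { intros x t; unfold partial_derive; simpl. rewrite Derive_scal_l.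
    now rewrite (is_derive_unique z x _ (D1 x)). }
  rewrite <- (Rmult_0_r (/ (2 * PI))), <- HD, <- RInt_mulc.
  + apply RInt_eq; intros t. rewrite (Rmult_comm _ (Derive h t)), (Rmult_comm _ (h t)).
    assert (Cut := cont2_x u t Cu). assert (Cft := cont2_x (flux u) t Cf).
    rewrite <- !mean_scal, <- mean_plus by ct. unfold mean; f_equal. apply RInt_eq; intros x.
    rewrite P01, P21, P10. unfold flux; ring.
  + apply (cont_RInt_param (fun x t => u x t * (partial_derive 0 1 (fun x t => z x * h t) x t
      - partial_derive 2 1 (fun x t => z x * h t) x t)
      + (u x t + u x t ^ 2 / 2) * partial_derive 1 0 (fun x t => z x * h t) x t)); [left; apply two_PI_pos|].
    replace (fun x t => u x t * (partial_derive 0 1 (fun x t => z x * h t) x t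
      - partial_derive 2 1 (fun x t => z x * h t) x t)
      + (u x t + u x t ^ 2 / 2) * partial_derive 1 0 (fun x t => z x * h t) x t)
    with (fun x t => u x t * (z x * Derive h t - z2 x * Derive h t) + (u x t + u x t ^ 2 / 2) * (z1 x * h t)).
    * ct2.
    * apply functional_extensionality; intros x; apply functional_extensionality; intros t.
      now rewrite P01, P21, P10.
Qed.

(** For z = cos (n x) or sin (n x) one has z - z'' = (1 + n^2) z; dividing by this factor produces
    [helm n]. *)
Lemma bbm_modes (u : R -> R -> R) (n : nat) (s t : R) : BBM_solution u ->
  fcos (fun x => u x t) (INR n) - fcos (fun x => u x s) (INR n) =
    RInt (fun r => - (INR n * helm n) * fsin (fun x => flux u x r) (INR n)) s t /\
  fsin (fun x => u x t) (INR n) - fsin (fun x => u x s) (INR n) =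
    RInt (fun r => INR n * helm n * fcos (fun x => flux u x r) (INR n)) s t.
Proof.
intros H. set (w := INR n). assert (Cu := C_H1_cont2 u (proj1 H)). assert (Cf := cont2_flux u Cu).
assert (Hw : 0 < 1 + w ^ 2) by (generalize (pow2_ge_0 w); lra).
assert (Hc : cont (fun r => fcos (fun x => flux u x r) w)).
{ apply (cont_mean_param (fun x r => flux u x r * cos (w * x))). ct2. }
assert (Hs : cont (fun r => fsin (fun x => flux u x r) w)).
{ apply (cont_mean_param (fun x r => flux u x r * sin (w * x))). ct2. }
assert (Cux := fun t => cont2_x u t Cu). assert (Cfx := fun t => cont2_x (flux u) t Cf).
split.
- generalize (bbm_tested u (fun x => cos (w * x)) (fun x => - w * sin (w * x)) (fun x => - w ^ 2 * cos (w * x)) H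
    (fun k => proj1 (CkR_trig k w)) (cos_period_INR n)
    ltac:(intros x; auto_derive; [exact I|ring]) ltac:(intros x; auto_derive; [exact I|ring]) ltac:(ct) ltac:(ct) s t).
  assert (E : forall t, mean (fun x => u x t * (cos (w * x) - - w ^ 2 * cos (w * x))) = (1 + w ^ 2) * fcos (fun x => u x t) w).
  { intros r. unfold fcos; rewrite <- mean_scal by (apply cont_mult; [apply Cux|ct]). apply mean_ext; intros; ring. }
  rewrite !E.
  rewrite (RInt_eq _ (fun r => - w * fsin (fun x => flux u x r) w)).
  + rewrite !RInt_mulc by exact Hs. unfold helm; fold w. intros E2.
    apply (Rmult_eq_reg_l (1 + w ^ 2)); [|lra]. rewrite Rmult_minus_distr_l, E2. field; lra.
  + intros r. unfold fsin; rewrite <- mean_scal by (apply cont_mult; [apply Cfx|ct]). apply mean_ext; intros; ring.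
- generalize (bbm_tested u (fun x => sin (w * x)) (fun x => w * cos (w * x)) (fun x => - w ^ 2 * sin (w * x)) H
    (fun k => proj2 (CkR_trig k w)) (sin_period_INR n)
    ltac:(intros x; auto_derive; [exact I|ring]) ltac:(intros x; auto_derive; [exact I|ring]) ltac:(ct) ltac:(ct) s t).
  assert (E : forall t, mean (fun x => u x t * (sin (w * x) - - w ^ 2 * sin (w * x))) = (1 + w ^ 2) * fsin (fun x => u x t) w).
  { intros r. unfold fsin; rewrite <- mean_scal by (apply cont_mult; [apply Cux|ct]). apply mean_ext; intros; ring. }
  rewrite !E.
  rewrite (RInt_eq _ (fun r => w * fcos (fun x => flux u x r) w)).
  + rewrite !RInt_mulc by exact Hc. unfold helm; fold w. intros E2.
    apply (Rmult_eq_reg_l (1 + w ^ 2)); [|lra]. rewrite Rmult_minus_distr_l, E2. field; lra.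
  + intros r. unfold fcos; rewrite <- mean_scal by (apply cont_mult; [apply Cfx|ct]). apply mean_ext; intros; ring.
Qed.

(** * Uniqueness *)

(* Partial Fourier sums of -d_x (1 - d_x^2)^{-1} g. *)
Definition drift (g : R -> R) (N : nat) (x : R) : R :=
  2 * sum1 (fun n => INR n * helm n * (fcos g (INR n) * sin (INR n * x) - fsin g (INR n) * cos (INR n * x))) N.

Lemma sum1_abs (h : nat -> R) (N : nat) : Rabs (sum1 h N) <= sum1 (fun n => Rabs (h n)) N.
Proof.
induction N as [|N IH]; simpl; [rewrite Rabs_R0; lra|].
eapply Rle_trans; [apply Rabs_triang|]; lra.
Qed.

(* AM-GM splits each term into a multiple of [helm n] and a Bessel term. *)
Lemma drift_bound (g : R -> R) (m : R) (N : nat) (x : R) : cont g -> 0 < m -> (forall x, Rabs (g x) <= m) ->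
  Rabs (drift g N x) <= 5 * m.
Proof.
intros Hg Hm Hb. unfold drift.
assert (HB : 2 * sum1 (fun n => fcos g (INR n) ^ 2 + fsin g (INR n) ^ 2) N <= m ^ 2).
{ eapply Rle_trans; [now apply bessel|]. rewrite <- (mean_const (m ^ 2)). apply mean_mono; [ct|ct|].
  intros y. generalize (Hb y) (Rabs_pos (g y)). replace (g y * g y) with (Rabs (g y) ^ 2); [intros; nra|].
  rewrite pow2_abs; ring. }
rewrite Rabs_mult, (Rabs_pos_eq 2) by lra.
assert (H : sum1 (fun n => Rabs (INR n * helm n * (fcos g (INR n) * sin (INR n * x) - fsin g (INR n) * cos (INR n * x)))) N
  <= m * sum1 helm N + / (2 * m) * sum1 (fun n => fcos g (INR n) ^ 2 + fsin g (INR n) ^ 2) N).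
{ rewrite <- !sum1_scal, <- sum1_plus. apply sum1_le. intros n _.
  set (w := INR n). set (a := fcos g w). set (b := fsin g w).
  assert (Hh := helm_pos n). assert (Hw : 0 <= w) by apply pos_INR.
  assert (Hhw : helm n * (1 + w ^ 2) = 1) by (unfold helm; fold w; field; nra).
  set (h := helm n) in *.
  assert (Hwh : 0 <= w * h) by (apply Rmult_le_pos; lra).
  (* Since w^2 h = 1 - h, the squared symbol of the first-order smoothing operator is h (1 - h),
     hence dominated by the summable [helm]. *)
  assert (Hwh2 : (w * h) ^ 2 <= h).
  { replace ((w * h) ^ 2) with (h * (h * (1 + w ^ 2)) - h ^ 2) by ring. rewrite Hhw. nra. }
  assert (Hs : Rabs (sin (w * x)) <= 1) by apply Rabs_le, SIN_bound.
  assert (Hc : Rabs (cos (w * x)) <= 1) by apply Rabs_le, COS_bound.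
  assert (H1 : Rabs (a * sin (w * x) - b * cos (w * x)) <= Rabs a + Rabs b).
  { eapply Rle_trans; [apply (Rabs_triang _ (- _))|]. rewrite Rabs_Ropp, !Rabs_mult.
    generalize (Rabs_pos a) (Rabs_pos b); intros; nra. }
  rewrite Rabs_mult, (Rabs_pos_eq (w * h)) by exact Hwh.
  apply Rle_trans with (w * h * (Rabs a + Rabs b)); [now apply Rmult_le_compat_l|].
  rewrite <- (pow2_abs a), <- (pow2_abs b). set (p := Rabs a). set (q := Rabs b).
  apply (Rmult_le_reg_l (2 * m)); [lra|].
  replace (2 * m * (m * h + / (2 * m) * (p ^ 2 + q ^ 2))) with (2 * m ^ 2 * h + p ^ 2 + q ^ 2) by (field; lra).
  generalize (pow2_ge_0 (m * (w * h) - p)) (pow2_ge_0 (m * (w * h) - q)).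
  assert (m ^ 2 * (w * h) ^ 2 <= m ^ 2 * h) by (apply Rmult_le_compat_l; [apply pow2_ge_0|exact Hwh2]).
  intros; nra. }
generalize (sum1_abs (fun n => INR n * helm n * (fcos g (INR n) * sin (INR n * x) - fsin g (INR n) * cos (INR n * x))) N).
generalize (sum1_helm_le N); intros.
(* The [helm] part is at most 2 m and the Bessel part at most m/4, so the total 2 (2 m + m/4) stays
   below 5 m. *)
assert (/ (2 * m) * sum1 (fun n => fcos g (INR n) ^ 2 + fsin g (INR n) ^ 2) N <= m / 4).
{ apply Rle_trans with (/ (2 * m) * (m ^ 2 / 2)); [|right; field; lra].
  apply Rmult_le_compat_l; [left; apply Rinv_0_lt_compat; lra|lra]. }
nra.
Qed.

(** Integrating the exponential weight from its minimum at [t0] gains a factor 1/L, forward and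
    backward in time alike. *)
Lemma RInt_exp_bound (h : R -> R) (c L t0 t : R) : cont h -> 0 <= c -> 0 < L ->
  (forall r, Rabs (r - t0) <= Rabs (t - t0) -> Rabs (h r) <= c * exp (L * Rabs (r - t0))) ->
  Rabs (RInt h t0 t) <= c / L * exp (L * Rabs (t - t0)).
Proof.
intros Hh Hc HL H.
assert (HcL : 0 <= c / L) by (apply Rmult_le_pos; [lra|left; now apply Rinv_0_lt_compat]).
destruct (Rle_lt_dec t0 t) as [Ht|Ht].
- eapply Rle_trans; [apply (RInt_abs_mono h (fun r => c * exp (L * (r - t0)))); [exact Ht|ct|ct|]|].
  + intros r Hr. rewrite <- (Rabs_pos_eq (r - t0)) by lra. apply H.
    rewrite !Rabs_pos_eq by lra; lra.
  + rewrite (RInt_fundamental (fun r => c / L * exp (L * (r - t0)))).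
    * rewrite (Rabs_pos_eq (t - t0)) by lra.
      assert (0 <= c / L * exp (L * (t0 - t0))) by (apply Rmult_le_pos; [exact HcL|left; apply exp_pos]).
      lra.
    * intros r; auto_derive; [exact I|unfold Rminus; field; lra].
    * ct.
- rewrite RInt_flip, Rabs_Ropp by exact Hh.
  eapply Rle_trans; [apply (RInt_abs_mono h (fun r => c * exp (L * (t0 - r)))); [lra|ct|ct|]|].
  + intros r Hr. replace (t0 - r) with (Rabs (r - t0)) by (rewrite Rabs_left; lra). apply H.
    rewrite !Rabs_left by lra; lra.
  + rewrite (RInt_fundamental (fun r => - (c / L) * exp (L * (t0 - r)))).
    * rewrite (Rabs_left (t - t0)) by lra. replace (- (t - t0)) with (t0 - t) by ring.
      assert (0 <= c / L * exp (L * (t0 - t0))) by (apply Rmult_le_pos; [exact HcL|left; apply exp_pos]).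
      lra.
    * intros r; auto_derive; [exact I|unfold Rminus; field; lra].
    * ct.
Qed.

Section Uniqueness.

Context (u w : R -> R -> R) (t0 : R) (Hu : BBM_solution u) (Hw : BBM_solution w)
  (Heq : forall x, u x t0 = w x t0).

(** Time comes first here so that [d t] and [G t] are functions of x to which the Fourier lemmas
    apply. *)
Let d t x := u x t - w x t.
Let G t x := flux u x t - flux w x t.

Let Cu : cont2 u := C_H1_cont2 u (proj1 Hu).
Let Cw : cont2 w := C_H1_cont2 w (proj1 Hw).
Let Cfu : cont2 (flux u) := cont2_flux u Cu.
Let Cfw : cont2 (flux w) := cont2_flux w Cw.

Lemma diff_cont (t : R) : cont (d t).
Proof. apply cont_minus; now apply cont2_x. Qed.

Lemma diff_flux_cont (t : R) : cont (G t).
Proof. apply cont_minus; now apply cont2_x. Qed.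

Lemma diff_fcos_cont (v : R) : cont (fun t => fcos (G t) v).
Proof. apply (cont_mean_param (fun x t => (flux u x t - flux w x t) * cos (v * x))). ct2. Qed.

Lemma diff_fsin_cont (v : R) : cont (fun t => fsin (G t) v).
Proof. apply (cont_mean_param (fun x t => (flux u x t - flux w x t) * sin (v * x))). ct2. Qed.

Lemma diff_modes (n : nat) (t : R) :
  fcos (d t) (INR n) = RInt (fun r => - (INR n * helm n) * fsin (G r) (INR n)) t0 t /\
  fsin (d t) (INR n) = RInt (fun r => INR n * helm n * fcos (G r) (INR n)) t0 t.
Proof.
destruct (bbm_modes u n t0 t Hu) as [U1 U2]. destruct (bbm_modes w n t0 t Hw) as [W1 W2].
set (v := INR n) in *.
assert (E0 : (fun x => u x t0) = (fun x => w x t0)) by (apply functional_extensionality; exact Heq).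
rewrite E0 in U1, U2.
assert (Xu := fun t => cont2_x u t Cu). assert (Xw := fun t => cont2_x w t Cw).
assert (Xfu := fun t => cont2_x _ t Cfu). assert (Xfw := fun t => cont2_x _ t Cfw).
assert (Lc : forall f g, cont f -> cont g -> fcos (fun x => f x - g x) v = fcos f v - fcos g v).
{ intros f g Hf Hg. unfold fcos; rewrite <- mean_minus by ct. apply mean_ext; intros; ring. }
assert (Ls : forall f g, cont f -> cont g -> fsin (fun x => f x - g x) v = fsin f v - fsin g v).
{ intros f g Hf Hg. unfold fsin; rewrite <- mean_minus by ct. apply mean_ext; intros; ring. }
assert (K1 : cont (fun r => fsin (fun x => flux u x r) v))
  by (apply (cont_mean_param (fun x r => flux u x r * sin (v * x))); ct2).
assert (K2 : cont (fun r => fsin (fun x => flux w x r) v))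
  by (apply (cont_mean_param (fun x r => flux w x r * sin (v * x))); ct2).
assert (K3 : cont (fun r => fcos (fun x => flux u x r) v))
  by (apply (cont_mean_param (fun x r => flux u x r * cos (v * x))); ct2).
assert (K4 : cont (fun r => fcos (fun x => flux w x r) v))
  by (apply (cont_mean_param (fun x r => flux w x r * cos (v * x))); ct2).
split.
- unfold d; rewrite Lc by auto.
  rewrite (RInt_eq _ (fun r => - (v * helm n) * fsin (fun x => flux u x r) v - - (v * helm n) * fsin (fun x => flux w x r) v)).
  + rewrite RInt_sub, <- U1, <- W1 by (apply cont_mult; [ct|assumption]).
    ring.
  + intros r. unfold G; rewrite Ls by auto. ring.
- unfold d; rewrite Ls by auto.
  rewrite (RInt_eq _ (fun r => v * helm n * fcos (fun x => flux u x r) v - v * helm n * fcos (fun x => flux w x r) v)).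
  + rewrite RInt_sub, <- U2, <- W2 by (apply cont_mult; [ct|assumption]).
    ring.
  + intros r. unfold G; rewrite Lc by auto. ring.
Qed.

Lemma diff_drift_cont (N : nat) (x : R) : cont (fun r => drift (G r) N x).
Proof.
unfold drift. apply cont_mult; [ct|]. induction N as [|N IH]; cbn [sum1]; [ct|].
apply cont_plus; [exact IH|]. apply cont_mult; [ct|].
apply cont_minus; (apply cont_mult; [|ct]); [apply diff_fcos_cont|apply diff_fsin_cont].
Qed.

Lemma diff_psum (N : nat) (x t : R) : psum (fun _ => 1) (d t) N x = RInt (fun r => drift (G r) N x) t0 t.
Proof.
induction N as [|N IH]; cbn [psum].
(* The zero mode carries the factor n = 0: the mean is conserved, so it stays 0 and matches the
   empty drift sum. *)
- rewrite <- fcos_0. change 0 with (INR 0). rewrite (proj1 (diff_modes 0 t)).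
  rewrite <- RInt_mulc by (apply cont_mult; [ct|apply diff_fsin_cont]).
  apply RInt_eq; intros r. unfold drift; simpl; ring.
- rewrite IH. destruct (diff_modes (S N) t) as [E1 E2]. rewrite E1, E2.
  set (v := INR (S N)).
  rewrite (Rmult_comm _ (cos (v * x))), (Rmult_comm _ (sin (v * x))).
  assert (C1 := diff_fcos_cont v). assert (C2 := diff_fsin_cont v). assert (C3 := diff_drift_cont N x).
  assert (C4 : cont (fun r => - (v * helm (S N)) * fsin (G r) v)) by (apply cont_mult; [ct|exact C2]).
  assert (C5 : cont (fun r => v * helm (S N) * fcos (G r) v)) by (apply cont_mult; [ct|exact C1]).
  rewrite <- (RInt_mulc (cos (v * x))), <- (RInt_mulc (sin (v * x))) by assumption.
  rewrite <- RInt_add by (apply cont_mult; [ct|assumption]).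
  assert (C6 : cont (fun r => cos (v * x) * (- (v * helm (S N)) * fsin (G r) v) + sin (v * x) * (v * helm (S N) * fcos (G r) v)))
    by (apply cont_plus; (apply cont_mult; [ct|assumption])).
  rewrite <- RInt_mulc by assumption.
  rewrite <- RInt_add; [|exact C3|apply cont_mult; [ct|exact C6]].
  apply RInt_eq; intros r. unfold drift; cbn [sum1]; fold v. ring.
Qed.

(** The Lipschitz factor [B], the drift constant 5 and the gain 1/L combine to 5 B m/L, which is m/2
    for L = 10 B. *)
Lemma diff_contract (B T L m : R) : 0 < B -> L = 10 * B -> 0 < m ->
  (forall x t, Rabs (t - t0) <= T -> Rabs (G t x) <= B * Rabs (d t x)) ->
  (forall x t, Rabs (t - t0) <= T -> Rabs (d t x) <= m * exp (L * Rabs (t - t0))) ->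
  forall x t, Rabs (t - t0) <= T -> Rabs (d t x) <= m / 2 * exp (L * Rabs (t - t0)).
Proof.
intros HB HL Hm HG H x t Ht.
apply fejer_bound.
- apply diff_cont.
- exact (proj1 (in_H1_minus _ _ (proj1 (proj1 Hu) t) (proj1 (proj1 Hw) t))).
- intros N. rewrite diff_psum.
  replace (m / 2) with (5 * (B * m) / L) by (subst L; field; lra).
  apply RInt_exp_bound; [apply diff_drift_cont|nra|lra|].
  intros r Hr.
  replace (5 * (B * m) * exp (L * Rabs (r - t0))) with (5 * (B * (m * exp (L * Rabs (r - t0))))) by ring.
  assert (He := exp_pos (L * Rabs (r - t0))).
  apply drift_bound; [apply diff_flux_cont| |].
  + apply Rmult_lt_0_compat; [exact HB|]. now apply Rmult_lt_0_compat.
  + intros y. eapply Rle_trans; [apply HG; lra|]. apply Rmult_le_compat_l; [lra|]. apply H; lra.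
Qed.

(** The flux difference is (1 + (u + w)/2)(u - w), and its factor is bounded only on bounded time
    intervals; hence the window of radius T = |t - t0|. Iterating [diff_contract] there gives a
    bound m/2^n times a fixed exponential. *)
Lemma bbm_unique : forall x t, u x t = w x t.
Proof.
intros x t.
pose (T := Rabs (t - t0)).
destruct (C_H1_bounded u (t0 - T) (t0 + T) (proj1 Hu)) as [Mu HMu].
destruct (C_H1_bounded w (t0 - T) (t0 + T) (proj1 Hw)) as [Mw HMw].
assert (Hball : forall s, Rabs (s - t0) <= T -> t0 - T <= s <= t0 + T).
{ intros s Hs. apply Rabs_le_between in Hs. lra. }
assert (HT : 0 <= T) by apply Rabs_pos.
assert (HM0 : 0 <= Mu /\ 0 <= Mw).
{ split; [apply Rle_trans with (Rabs (u 0 t0)); [apply Rabs_pos|apply HMu; lra]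
  |apply Rle_trans with (Rabs (w 0 t0)); [apply Rabs_pos|apply HMw; lra]]. }
pose (B := 1 + (Mu + Mw)). pose (L := 10 * B).
assert (HB : 0 < B) by (unfold B; lra).
assert (HG : forall x t, Rabs (t - t0) <= T -> Rabs (G t x) <= B * Rabs (d t x)).
{ intros y s Hs. unfold G, d, flux.
  replace (u y s + u y s ^ 2 / 2 - (w y s + w y s ^ 2 / 2))
    with ((1 + (u y s + w y s) / 2) * (u y s - w y s)) by field.
  rewrite Rabs_mult. apply Rmult_le_compat_r; [apply Rabs_pos|].
  specialize (HMu y s (Hball s Hs)). specialize (HMw y s (Hball s Hs)).
  apply Rabs_le_between in HMu. apply Rabs_le_between in HMw. unfold B.
  apply Rabs_le; lra. }
pose (m := Mu + Mw + 1).
assert (Hm : 0 < m) by (unfold m; lra).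
assert (Hn : forall n x t, Rabs (t - t0) <= T -> Rabs (d t x) <= m / 2 ^ n * exp (L * Rabs (t - t0))).
{ induction n as [|n IH].
  - intros y s Hs. simpl. rewrite Rdiv_1_r.
    specialize (HMu y s (Hball s Hs)). specialize (HMw y s (Hball s Hs)).
    assert (He : 1 <= exp (L * Rabs (s - t0))).
    { eapply Rle_trans; [|apply exp_ineq1_le].
      assert (0 <= L * Rabs (s - t0)) by (apply Rmult_le_pos; [unfold L; lra|apply Rabs_pos]). lra. }
    apply Rle_trans with m; [|nra]. unfold d, m.
    eapply Rle_trans; [apply (Rabs_triang _ (- _))|]. rewrite Rabs_Ropp; lra.
  - intros y s Hs. replace (m / 2 ^ S n) with (m / 2 ^ n / 2) by (simpl; field; apply pow_nonzero; lra).
    apply (diff_contract B T L); auto. apply Rdiv_lt_0_compat; [exact Hm|apply pow_lt; lra]. }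
enough (d t x = 0) by (unfold d in *; lra).
apply Rabs_eq_0. apply Rle_antisym; [|apply Rabs_pos].
pose (E := m * exp (L * T)).
assert (Hlim : is_lim_seq (fun n => E * (/ 2) ^ n) 0).
{ replace (Finite 0) with (Rbar_mult E 0) by (simpl; f_equal; ring).
  apply is_lim_seq_scal_l. apply is_lim_seq_geom. rewrite Rabs_pos_eq; lra. }
apply (is_lim_seq_le (fun _ => Rabs (d t x)) (fun n => E * (/ 2) ^ n) (Rabs (d t x)) 0); auto.
- intros n. eapply Rle_trans; [apply (Hn n); unfold T; lra|]. fold T. right; unfold E.
  rewrite pow_inv. field. apply pow_nonzero; lra.
- apply is_lim_seq_const.
Qed.

End Uniqueness.

(** * Reflections *)

Definition smooth2 (g : R -> R -> R) : Prop := forall n x t, ex_diff_n g n x t.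
Definition dx (g : R -> R -> R) (x t : R) : R := Derive (fun y => g y t) x.
Definition dt (g : R -> R -> R) (x t : R) : R := Derive (fun s => g x s) t.

Lemma smooth2_cont2 (g : R -> R -> R) : smooth2 g -> cont2 g.
Proof. intros H x t; apply (H 0%nat). Qed.

Lemma smooth2_dx (g : R -> R -> R) : smooth2 g -> smooth2 (dx g).
Proof. intros H n x t. destruct (H (S n) x t) as [_ [_ [_ [H1 _]]]]. exact H1. Qed.

Lemma smooth2_dt (g : R -> R -> R) : smooth2 g -> smooth2 (dt g).
Proof. intros H n x t. destruct (H (S n) x t) as [_ [_ [_ [_ H1]]]]. exact H1. Qed.

Lemma smooth2_ex_dx (g : R -> R -> R) (x t : R) : smooth2 g -> ex_derive (fun y => g y t) x.
Proof. intros H. destruct (H 1%nat x t) as [_ [H1 _]]. exact H1. Qed.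

Lemma smooth2_ex_dt (g : R -> R -> R) (x t : R) : smooth2 g -> ex_derive (fun s => g x s) t.
Proof. intros H. destruct (H 1%nat x t) as [_ [_ [H1 _]]]. exact H1. Qed.

Lemma is_derive_reflect (f : R -> R) (c a x : R) : (forall y, ex_derive f y) ->
  is_derive (fun y => a * f (c - y)) x (- a * Derive f (c - x)).
Proof.
intros H. replace (- a * Derive f (c - x)) with (a * (-1 * Derive f (c - x))) by ring.
apply (is_derive_scal (fun y => f (c - y)) x a).
apply (is_derive_comp f (fun y => c - y) x (Derive f (c - x)) (-1)).
- now apply Derive_correct.
- auto_derive; [exact I|ring].
Qed.

(** Each x-derivative of g(c - x, t) changes the sign, so the induction needs the arbitrary factor
    [a]. *)
Lemma smooth2_reflect (g : R -> R -> R) (c a : R) : smooth2 g -> smooth2 (fun x t => a * g (c - x) t).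
Proof.
intros H n; revert g a H; induction n as [|n IH]; intros g a H x t.
- split; [|exact I]. assert (Hg := smooth2_cont2 g H).
  apply (cont2_mult (fun _ _ => a) (fun x t => g (c - x) t)); ct2.
- assert (Hg := smooth2_cont2 g H).
  split; [apply (cont2_mult (fun _ _ => a) (fun x t => g (c - x) t)); ct2|].
  split; [|split; [|split]].
  + eexists. apply (is_derive_reflect (fun y => g y t)). intros y; now apply smooth2_ex_dx.
  + apply (ex_derive_mult (fun _ => a) (fun s => g (c - x) s)); [apply ex_derive_const|now apply smooth2_ex_dt].
  + replace (fun u v => Derive (fun z => a * g (c - z) v) u) with (fun u v => - a * dx g (c - u) v).
    * apply IH; now apply smooth2_dx.
    * apply functional_extensionality; intros u; apply functional_extensionality; intros v.
      symmetry; apply is_derive_unique, (is_derive_reflect (fun y => g y v)). intros y; now apply smooth2_ex_dx.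
  + replace (fun u v => Derive (fun z => a * g (c - u) z) v) with (fun u v => a * dt g (c - u) v).
    * apply IH; now apply smooth2_dt.
    * apply functional_extensionality; intros u; apply functional_extensionality; intros v.
      symmetry; apply Derive_scal.
Qed.

Lemma periodic_Derive (f : R -> R) : periodic f -> periodic (Derive f).
Proof.
intros H x. unfold Derive. apply f_equal, Lim_ext. intros h.
rewrite <- (H x), <- (H (x + h)). do 3 f_equal; ring.
Qed.

Lemma periodic_dx (g : R -> R -> R) : (forall t, periodic (fun x => g x t)) -> forall t, periodic (fun x => dx g x t).
Proof. intros H t. apply (periodic_Derive (fun x => g x t)), H. Qed.

Lemma periodic_dt (g : R -> R -> R) : (forall t, periodic (fun x => g x t)) -> forall t, periodic (fun x => dt g x t).
Proof. intros H t x. apply Derive_ext. intros s; apply H. Qed.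

Lemma RInt_dx_periodic (g : R -> R -> R) (t : R) : smooth2 g -> (forall t, periodic (fun x => g x t)) ->
  RInt (fun x => dx g x t) 0 (2 * PI) = 0.
Proof.
intros Hs Hp. rewrite (RInt_fundamental (fun x => g x t)).
- rewrite <- (Hp t 0). rewrite Rplus_0_l. apply Rminus_diag_eq; reflexivity.
- intros x; apply Derive_correct; now apply smooth2_ex_dx.
- apply cont2_x, smooth2_cont2; now apply smooth2_dx.
Qed.

Lemma cont2_swap (g : R -> R -> R) : cont2 g -> cont2 (fun t x => g x t).
Proof.
intros H t x e. destruct (H x t e) as [d Hd]. exists d; intros u v Hu Hv; now apply Hd.
Qed.

(** Differentiation under the integral; it disposes of the phi_t term produced by the constant -2 of
    the reflection, since a test function vanishes at both end times. *)
Lemma RInt_RInt_dt (g : R -> R -> R) (a b c d : R) : a <= b -> smooth2 g ->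
  RInt (fun t => RInt (fun x => dt g x t) a b) c d = RInt (fun x => g x d) a b - RInt (fun x => g x c) a b.
Proof.
intros Hab Hs.
assert (Hdt := smooth2_cont2 _ (smooth2_dt g Hs)).
apply (RInt_fundamental (fun t => RInt (fun x => g x t) a b)).
- intros t. apply (is_derive_RInt_param (fun t x => g x t)).
  + apply filter_forall; intros s x _. now apply smooth2_ex_dt.
  + intros x _. apply (cont2_swap (dt g) Hdt).
  + apply filter_forall; intros s. apply cont_ex_RInt, cont2_x, smooth2_cont2, Hs.
- now apply cont_RInt_param.
Qed.

Definition reflected (c : R) (u : R -> R -> R) (x t : R) : R := -2 - u (c - x) t.

Lemma H1_weight_neg (f : R -> R) (k : Z) : cont f -> H1_weight (fun x => - f x) k = H1_weight f k.
Proof.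
intros Hc. rewrite !H1_weight_eq. unfold fcos, fsin.
rewrite (mean_ext _ (fun x => - (f x * cos (IZR k * x)))) by (intros; ring).
rewrite (mean_ext (fun x => - f x * sin (IZR k * x)) (fun x => - (f x * sin (IZR k * x)))) by (intros; ring).
rewrite !mean_opp by ct. ring.
Qed.

Lemma C_H1_reflected (c : R) (u : R -> R -> R) : C_H1 u -> C_H1 (reflected c u).
Proof.
intros [HH HC]; split.
- intros t. apply (in_H1_minus (fun _ => -2) (fun x => u (c - x) t)); [apply in_H1_const|].
  apply (in_H1_reflect (fun x => u x t)), HH.
- intros t. apply (filterlim_ext (fun s => H1_norm (fun x => u x s - u x t))); [|apply HC].
  intros s. unfold H1_norm. f_equal. f_equal. apply functional_extensionality; intros k.
  (* The increment of the reflected function from t to s is the reflection of u(.,t) - u(.,s): the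
     minus sign exchanges the two times. *)
  destruct (in_H1_minus _ _ (HH t) (HH s)) as [Hp [Hc _]]. change (cont (fun x => u x t - u x s)) in Hc.
  transitivity (H1_weight (fun x => u x t - u x s) k).
  + rewrite <- (H1_weight_neg (fun x => u x t - u x s)) by exact Hc. f_equal. apply functional_extensionality; intros x; ring.
  + rewrite <- (H1_weight_reflect _ c k Hc Hp). f_equal. apply functional_extensionality; intros x.
    unfold reflected; ring.
Qed.

(** With v = 1 + u the reflection is v(x) -> -v(c - x), which leaves the flux (v^2 - 1)/2 unchanged
    apart from moving the point. Testing with phi therefore amounts to testing [u] with the
    reflected phi, up to an overall sign and the terms -2 phi_t + 2 phi_xxt, whose integrals
    vanish. *)
Lemma bbm_reflected (c : R) (u : R -> R -> R) : BBM_solution u -> BBM_solution (reflected c u).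
Proof.
intros [HC HD]. split; [now apply C_H1_reflected|].
intros M phi HM [Tp [Ts Tz]]. change (smooth2 phi) in Ts.
pose (rho := fun x t => 1 * phi (c - x) t).
assert (Rs : smooth2 rho) by now apply smooth2_reflect.
assert (Rp : forall t, periodic (fun x => rho x t)).
{ intros t x. unfold rho. rewrite <- (Tp t (c - (x + 2 * PI))). do 2 f_equal; ring. }
assert (Rt : test_function M rho).
{ split; [exact Rp|split; [exact Rs|]]. intros x t Ht. unfold rho. rewrite (Tz (c - x) t Ht); ring. }
specialize (HD M rho HM Rt).
assert (Cu := C_H1_cont2 u HC).
pose (H := fun x t => u x t * (dt rho x t - dx (dx (dt rho)) x t) + (u x t + u x t ^ 2 / 2) * dx rho x t).
change (RInt (fun t => RInt (fun x => H x t) 0 (2 * PI)) (- M) M = 0) in HD.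
assert (D1 := smooth2_cont2 _ (smooth2_dt _ Rs)).
assert (D2 := smooth2_cont2 _ (smooth2_dx _ (smooth2_dx _ (smooth2_dt _ Rs)))).
assert (D3 := smooth2_cont2 _ (smooth2_dx _ Rs)).
assert (E1 := smooth2_cont2 _ (smooth2_dt _ Ts)).
assert (E2 := smooth2_cont2 _ (smooth2_dx _ (smooth2_dx _ (smooth2_dt _ Ts)))).
assert (CH : cont2 H) by (unfold H; ct2).
assert (PH : forall t, periodic (fun x => H x t)).
{ intros t x. unfold H.
  rewrite (periodic_dt rho Rp t x), (periodic_dx rho Rp t x).
  rewrite (periodic_dx _ (periodic_dx _ (periodic_dt rho Rp)) t x).
  now rewrite (proj1 (proj1 HC t) x). }
assert (R1 : forall x t, dt rho x t = dt phi (c - x) t).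
{ intros x t. unfold rho. apply Derive_ext; intros; ring. }
assert (Rx : forall (g : R -> R -> R) a x t, smooth2 g -> dx (fun x t => a * g (c - x) t) x t = - a * dx g (c - x) t).
{ intros g a x t Hg. apply is_derive_unique, (is_derive_reflect (fun y => g y t)).
  intros; now apply smooth2_ex_dx. }
assert (R3 : forall x t, dx rho x t = - dx phi (c - x) t).
{ intros x t. unfold rho; rewrite Rx by exact Ts. ring. }
assert (R2 : forall x t, dx (dx (dt rho)) x t = dx (dx (dt phi)) (c - x) t).
{ intros x t.
  replace (dt rho) with (fun x t => 1 * dt phi (c - x) t)
    by (apply functional_extensionality; intros y; apply functional_extensionality; intros s; rewrite R1; ring).
  replace (dx (fun x t => 1 * dt phi (c - x) t)) with (fun x t => - (1) * dx (dt phi) (c - x) t)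
    by (apply functional_extensionality; intros y; apply functional_extensionality; intros s;
        symmetry; apply Rx; now apply smooth2_dt).
  rewrite Rx by now apply smooth2_dx, smooth2_dt. ring. }
assert (E : forall t, RInt (fun x => reflected c u x t * (dt phi x t - dx (dx (dt phi)) x t)
    + (reflected c u x t + reflected c u x t ^ 2 / 2) * dx phi x t) 0 (2 * PI) =
    -2 * RInt (fun x => dt phi x t) 0 (2 * PI) - RInt (fun x => H x t) 0 (2 * PI)).
{ intros t.
  rewrite (RInt_eq _ (fun x => -2 * dt phi x t + 2 * dx (dx (dt phi)) x t - H (c - x) t)).
  - assert (CHt := cont2_x H t CH).
    assert (E1t := cont2_x _ t E1). assert (E2t := cont2_x _ t E2).
    assert (CHr : cont (fun x => H (c - x) t)) by (apply (cont_comp (fun x => H x t) (fun x => c - x)); ct).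
    rewrite RInt_sub, RInt_add, !RInt_mulc by ct.
    rewrite (RInt_dx_periodic (dx (dt phi))).
    + rewrite (RInt_reflect (fun x => H x t)) by exact CHt.
      replace (c - 0) with (c - 2 * PI + 2 * PI) by ring. rewrite (RInt_period (fun x => H x t)) by auto. now rewrite Rmult_0_r, Rplus_0_r.
    + now apply smooth2_dx, smooth2_dt.
    + now apply periodic_dx, periodic_dt.
  - intros x. unfold H. rewrite R1, R2, R3. replace (c - (c - x)) with x by ring. unfold reflected. field. }
change (RInt (fun t => RInt (fun x => reflected c u x t * (dt phi x t - dx (dx (dt phi)) x t)
    + (reflected c u x t + reflected c u x t ^ 2 / 2) * dx phi x t) 0 (2 * PI)) (- M) M = 0).
rewrite (RInt_eq _ _ _ _ E).
assert (HP : 0 <= 2 * PI) by (left; apply two_PI_pos).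
rewrite RInt_sub, RInt_mulc, HD.
- rewrite RInt_RInt_dt by assumption.
  rewrite (RInt_eq (fun x => phi x M) (fun _ => 0)) by (intros; apply Tz, Rle_abs).
  rewrite (RInt_eq (fun x => phi x (- M)) (fun _ => 0)) by (intros; apply Tz; rewrite Rabs_Ropp; apply Rle_abs).
  rewrite Rminus_diag, Rmult_0_r; apply Rminus_0_r.
- now apply cont_RInt_param.
- apply cont_mult; [ct|now apply cont_RInt_param].
- now apply cont_RInt_param.
Qed.

Lemma bbm_reflected_iff (c : R) (u : R -> R -> R) : BBM_solution u <-> BBM_solution (reflected c u).
Proof.
split; [apply bbm_reflected|]. intros H.
replace u with (reflected c (reflected c u)); [now apply bbm_reflected|].
apply functional_extensionality; intros x; apply functional_extensionality; intros t.
unfold reflected. replace (c - (c - x)) with x by ring. ring.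
Qed.


Theorem mainTheorem11 :
  forall x0 : R,
  (* (i) *)
  (forall u : R -> R -> R, BBM_solution u ->
     (exists t : R, psi u x0 t = - (1 / 2)) ->
     forall x t : R, u x t = -1)
  /\
  (* (ii), invariance *)
  (forall u : R -> R -> R,
     BBM_solution u <-> BBM_solution (fun x t => -2 - u (2 * x0 - x) t))
  /\
  (* (ii), odd data *)
  (forall (u : R -> R -> R) (u0 : R -> R), BBM_solution u ->
     (forall x : R, u x 0 = u0 x) ->
     odd_about x0 (fun x => 1 + u0 x) ->
     ~ (forall x : R, 1 + u0 x = 0) ->
     (forall t : R, u x0 t = -1) /\
     ~ (exists c : R, forall x t : R, u x t = c))
  /\
  (* (ii), the example of such data *)
  (in_H1 (fun x => -1 + sin (x - x0)) /\
   odd_about x0 (fun x => 1 + (-1 + sin (x - x0))) /\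
   ~ (forall x : R, 1 + (-1 + sin (x - x0)) = 0)).
Proof.
intros x0. split; [|split; [|split; [|split; [|split]]]].
- intros u Hu [t0 Ht] x t.
  destruct (proj1 (proj1 Hu) t0) as [Hp [Hc _]].
  assert (H1 : forall y, u y t0 = -1)
    by exact (inv_helmholtz_flux_rigid (fun y => u y t0) x0 Hc Hp Ht).
  (* At time [t0] the solution coincides with each of its reflections. *)
  assert (E := bbm_unique u (reflected (2 * x) u) t0 Hu (bbm_reflected _ _ Hu)
    ltac:(intros y; unfold reflected; rewrite !H1; ring) x t).
  (* The reflection is centred at the point [x] under study, which it fixes: u = -2 - u there. *)
  unfold reflected in E. replace (2 * x - x) with x in E by ring. lra.
- intros u. apply bbm_reflected_iff.
- intros u u0 Hu H0 Hodd Hne. split.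
  + intros t.
    assert (E := bbm_unique u (reflected (2 * x0) u) 0 Hu (bbm_reflected _ _ Hu)
      ltac:(intros y; unfold reflected; rewrite !H0; generalize (Hodd y); lra) x0 t).
    unfold reflected in E. replace (2 * x0 - x0) with x0 in E by ring. lra.
  (* Oddness applied to a constant gives 1 + c = -(1 + c), so the data would vanish identically. *)
  + intros [c Hcst]. apply Hne. intros x.
    generalize (Hodd x). rewrite <- !H0, !Hcst. lra.
- replace (fun x => -1 + sin (x - x0)) with (fun x => -1 + 1 * sin (x - x0)); [apply in_H1_sin|].
  apply functional_extensionality; intros x; ring.
- intros x. replace (2 * x0 - x - x0) with (- (x - x0)) by ring. rewrite sin_neg; ring.
- intros H. generalize (H (x0 + PI / 2)). replace (x0 + PI / 2 - x0) with (PI / 2) by ring.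
  rewrite sin_PI2; lra.
Qed.
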